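(* Let $T\subseteq\mathrm{R}^{k+\ell}$ be a definable set. Then there exist constants $C_1,C_2$ and a finite family $\mathcal{A}$ of definable sets, $|\mathcal{A}|\le C_1$, with $A\subseteq\mathrm{R}^k\times\mathrm{R}^{2(2^k-1)\ell}$ for each $A\in\mathcal{A}$, which satisfy the following property. For any $n$ points $y_1,\dots,y_n\in\mathrm{R}^\ell$, some sub-collection of the sets $$\pi_{\le k}\Big(\pi_{>k}^{-1}\big(y_{i_1},\dots,y_{i_{2(2^k-1)}}\big)\cap A\Big),\qquad A\in\mathcal{A},\ 1\le i_1,\dots,i_{2(2^k-1)}\le n,$$ forms a semi-cylindrical decomposition of $\mathrm{R}^k$ adapted to $T_{y_1},\dots,T_{y_n}$, where $\pi_{\le k}:\mathrm{R}^{k+2(2^k-1)\ell}\to\mathrm{R}^k$ and $\pi_{>k}:\mathrm{R}^{k+2(2^k-1)\ell}\to\mathrm{R}^{2(2^k-1)\ell}$ are the projections onto the first $k$ and onto the last $2(2^k-1)\ell$ coordinates. Also, the number of sets in the decomposition is bounded by $C_2\,n^{2k-1}$.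
   Context: $\mathrm{R}$ is a real closed field and ''definable'' means definable in a fixed o-minimal structure on $\mathrm{R}$, that is, a sequence $(\mathcal{S}_m)_{m\ge1}$ of families of subsets of $\mathrm{R}^m$ such that each $\mathcal{S}_m$ is a Boolean algebra containing all algebraic subsets of $\mathrm{R}^m$, the families are closed under Cartesian products and under the projections $\mathrm{R}^{m+1}\to\mathrm{R}^m$ forgetting the last coordinate, and the elements of $\mathcal{S}_1$ are precisely the finite unions of points and open intervals. For $y\in\mathrm{R}^\ell$, $T_y=\{x\in\mathrm{R}^k\mid (x,y)\in T\}$. Cylindrical sets are defined inductively: a cylindrical set of $\mathrm{R}$ is a point $\{a\}$ or an open interval $(a,b)$, with $a<b$ in $\mathrm{R}\cup\{\pm\infty\}$. Given a cylindrical set $X$ of $\mathrm{R}^{k-1}$, a cylindrical set of $\mathrm{R}^k$ over $X$ is either a graph $\{(x,a)\in X\times\mathrm{R}\mid \xi(x)=a\}$ with $\xi:X\to\mathrm{R}$ definable and continuous, or a band $\{(x,a)\in X\times\mathrm{R}\mid \xi_1(x)<a<\xi_2(x)\}$ with $\xi_1<\xi_2$ on $X$, where each of $\xi_1,\xi_2$ is a definable continuous function $X\to\mathrm{R}$ or (for $\xi_1$) identically $-\infty$, (for $\xi_2$) identically $+\infty$. A partition of $\mathrm{R}^k$ into definable sets is a semi-cylindrical decomposition if each cell of it is a cylindrical set. A partition is adapted to sets $X_1,\dots,X_n$ if for each cell $C$ and each $i$ either $C\subseteq X_i$ or $C\cap X_i=\emptyset$. *)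

(* Defs.v *)
From mathcomp Require Import all_boot all_order all_algebra.
From mathcomp Require mpoly.
From mathcomp Require Import all_classical.
From mathcomp Require Import interval_inference ereal topology normedtype.

Set Implicit Arguments.
Unset Strict Implicit.
Unset Printing Implicit Defensive.

Import Order.TTheory GRing.Theory Num.Theory numFieldNormedType.Exports.

Local Open Scope classical_set_scope.
Local Open Scope ring_scope.

(* R^m is represented by the row vectors 'rV[R]_m, whose topology is the      *)
(* product of the order topologies on R.                                      *)

Definition open_interval (R : rcfType) (a b : \bar R) : set R :=
  [set t | (a < t%:E)%E /\ (t%:E < b)%E].

Definition point_or_open_interval (R : rcfType) (I : set R) : Prop :=
  (exists a : R, I = [set a]) \/
  (exists a b : \bar R, (a < b)%E /\ I = open_interval a b).

Definition algebraic_set (R : rcfType) (m : nat) (A : set 'rV[R]_m) : Prop :=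
  exists (N : nat) (p : 'I_N -> mpoly.mpoly m R),
    A = [set x : 'rV[R]_m |
           forall j, mpoly.meval (fun i => x ord0 i) (p j) = 0].

Definition init (R : rcfType) (m : nat) (z : 'rV[R]_m.+1) : 'rV[R]_m :=
  col' ord_max z.

(* The family of the S_m is indexed by all m, but only constrained for m > 0. *)
Record ominimal_structure (R : rcfType) := OminimalStructure {
  definable : forall m, set (set 'rV[R]_m);
  definable0 : forall m, (0 < m)%N -> definable (set0 : set 'rV[R]_m);
  definableU : forall m (A B : set 'rV[R]_m), (0 < m)%N ->
    definable A -> definable B -> definable (A `|` B);
  definableC : forall m (A : set 'rV[R]_m), (0 < m)%N ->
    definable A -> definable (~` A);
  definable_algebraic : forall m (A : set 'rV[R]_m), (0 < m)%N ->
    algebraic_set A -> definable A;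
  definable_prod : forall m n (A : set 'rV[R]_m) (B : set 'rV[R]_n),
    (0 < m)%N -> (0 < n)%N -> definable A -> definable B ->
    definable [set z : 'rV[R]_(m + n) | A (lsubmx z) /\ B (rsubmx z)];
  definable_proj : forall m (A : set 'rV[R]_m.+1), (0 < m)%N ->
    definable A -> definable (@init R m @` A);
  definable1P : forall A : set 'rV[R]_1,
    definable A <->
    exists F : set (set R), [/\ finite_set F,
      (forall I, F I -> point_or_open_interval I) &
      A = [set x | (\bigcup_(I in F) I) (x ord0 ord0)]]
}.

Section Cylindrical.
Variables (R : rcfType) (S : ominimal_structure R).

Definition graph_over k (X : set 'rV[R]_k) (xi : 'rV[R]_k -> R) :
    set 'rV[R]_k.+1 :=
  [set z | X (init z) /\ xi (init z) = z ord0 ord_max].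

Definition band_over k (X : set 'rV[R]_k) (xi1 xi2 : 'rV[R]_k -> \bar R) :
    set 'rV[R]_k.+1 :=
  [set z | [/\ X (init z), (xi1 (init z) < (z ord0 ord_max)%:E)%E &
               ((z ord0 ord_max)%:E < xi2 (init z))%E]].

(* A function X -> R is given by a total function, only the values of which   *)
(* on X are relevant.                                                         *)
Definition definable_continuous k (X : set 'rV[R]_k) (xi : 'rV[R]_k -> R) :=
  definable S (graph_over X xi) /\ {within X, continuous xi}.

(* e is the infinite value allowed for a bound of a band. *)
Definition band_bound k (X : set 'rV[R]_k) (e : \bar R)
    (xi : 'rV[R]_k -> \bar R) :=
  (exists f : 'rV[R]_k -> R, definable_continuous X f /\
     forall x, X x -> xi x = (f x)%:E) \/
  (forall x, X x -> xi x = e).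

Inductive cylindrical : forall k, set 'rV[R]_k -> Prop :=
| cylindrical_point (a : R) :
    cylindrical [set x : 'rV[R]_1 | x ord0 ord0 = a]
| cylindrical_interval (a b : \bar R) : (a < b)%E ->
    cylindrical [set x : 'rV[R]_1 | open_interval a b (x ord0 ord0)]
| cylindrical_graph k (X : set 'rV[R]_k) (xi : 'rV[R]_k -> R) :
    cylindrical X -> definable_continuous X xi ->
    cylindrical (graph_over X xi)
| cylindrical_band k (X : set 'rV[R]_k) (xi1 xi2 : 'rV[R]_k -> \bar R) :
    cylindrical X ->
    band_bound X -oo%E xi1 -> band_bound X +oo%E xi2 ->
    (forall x, X x -> (xi1 x < xi2 x)%E) ->
    cylindrical (band_over X xi1 xi2).

Definition semi_cylindrical_decomposition k (D : set (set 'rV[R]_k)) : Prop :=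
  [/\ partition D id [set: 'rV[R]_k],
      (forall C, D C -> definable S C) &
      (forall C, D C -> cylindrical C)].

End Cylindrical.

Definition adapted (T I : Type) (D : set (set T)) (X : I -> set T) : Prop :=
  forall C i, D C -> C `<=` X i \/ C `&` X i = set0.

Definition fiber (R : rcfType) (k l : nat) (T : set 'rV[R]_(k + l))
    (y : 'rV[R]_l) : set 'rV[R]_k :=
  [set x | T (row_mx x y)].

(* The point (y_0, ..., y_(m-1)) of R^(m * l): mxvec concatenates the rows. *)
Definition concat (R : rcfType) (m l : nat) (y : 'I_m -> 'rV[R]_l) :
    'rV[R]_(m * l) :=
  mxvec (\matrix_(j < m) y j).

Definition proj_slice (R : rcfType) (k p : nat) (A : set 'rV[R]_(k + p))
    (w : 'rV[R]_p) : set 'rV[R]_k :=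
  lsubmx @` (rsubmx @^-1` [set w] `&` A).

(* Main.v *)
Require Import Defs.
From mathcomp Require Import all_boot all_order all_algebra.
From mathcomp Require mpoly.
Import (canonicals) mpoly.
From mathcomp Require Import all_classical.
From mathcomp Require Import interval_inference ereal topology normedtype.
From mathcomp Require Import ring lra.

Import Order.TTheory GRing.Theory Num.Theory numFieldNormedType.Exports.

(** The decomposition is built by induction on [k]. Write a point of the space as [(x, t)] with
    [t] the last coordinate. By uniform finiteness ([uniform_finiteness]) the boundary
    points in the variable [t] of the fibres of the sets [T_y] lie on boundedly many graphs of
    definable functions [f_j (x, y)], so the points [y_1, ..., y_n] give a number of
    functions [g_p] on the base that is linear in [n]. Over each [x] their values cut the
    line into points and gaps, and on a gap, membership in each of the given sets is constant. For
    fixed [p] and [q], the set of [x] over which [g_p] and [g_q] bound a gap is described by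
    conditions that involve, besides the two parameters of [p] and [q], one further parameter [y_m] at
    a time. The induction hypothesis, applied to the [n] triples formed by these two
    parameters and [y_m], therefore decomposes the base for this pair alone, and the pieces over
    which the gap exists give the cells bounded by [g_p] and [g_q]. Different pairs use
    unrelated decompositions of the base, which is harmless since the projections of the
    cells need not be disjoint. There are [O(n^2)] pairs, so the number of cells is
    multiplied by [n^2] at each step, and two parameters are added at each step; for [k = 1] a gap is
    determined by one of its ends, whence the exponent [2k - 1]
    ([decomposable_step]).

    Cells have to be bounded by continuous functions. Among the conditions on [x] one
    therefore includes the pieces of a finite definable cover on which the functions
    [f_j (_, y)] are continuous ([piecewise_continuity]).

    The facts from o-minimal geometry are derived from the finiteness axiom for definable
    subsets of the line. The main tool is that radii can be made uniform ([uniform_radius]): if a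
    definable property holds at every point of an interval with some positive radius,
    then on a subinterval it holds with a constant radius. This makes one-variable functions
    monotone and continuous on subintervals ([locally_monotone]), and by induction on
    the dimension definable functions are continuous on a dense open set
    ([generic_continuity]). Uniform finiteness follows by induction on the number of
    parameters: in the last parameter the cardinality of the fibres can change only at
    finitely many definable values ([uniformly_finite_step]). *)

(** * First-order definability over coordinatised types *)

Section Coordinates.
Set Implicit Arguments.
Unset Strict Implicit.
Unset Printing Implicit Defensive.
Local Open Scope classical_set_scope.
Local Open Scope ring_scope.

Variables (R : rcfType).

(** Types whose points are tuples of reals. Working over them, formulas are written
    with pairs, rows and tuples of points instead of coordinates of one long row. *)
Record dtype := DType {
  dsort :> Type;
  ddim : nat;
  dco : dsort -> 'I_ddim -> R;
  dmk : ('I_ddim -> R) -> dsort;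
  dcoK : forall x, dmk (dco x) = x;
  dmkK : forall v i, dco (dmk v) i = v i }.

Lemma dco_inj (E : dtype) (x y : E) : (forall i, dco x i = dco y i) -> x = y.
Proof. by move=> h; rewrite -(dcoK x) -(dcoK y); congr dmk; apply/funext. Qed.

Definition scalar_dtype : dtype.
Proof.
refine (@DType R 1 (fun x _ => x) (fun v => v ord0) _ _); first by [].
by move=> v i; rewrite (ord1 i).
Defined.

Definition row_dtype (n : nat) : dtype.
Proof.
refine (@DType 'rV[R]_n n (fun x i => x ord0 i) (fun v => \row_i v i) _ _).
- by move=> x; apply/rowP => i; rewrite mxE.
- by move=> v i; rewrite mxE.
Defined.

Definition pair_dtype (E F : dtype) : dtype.
Proof.
refine (@DType (E * F) (ddim E + ddim F)
  (fun x i => match fintype.split i with inl j => dco x.1 j | inr j => dco x.2 j end)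
  (fun v => (dmk (fun j => v (lshift _ j)), dmk (fun j => v (rshift _ j)))) _ _).
- move=> [x y]; congr pair; apply: dco_inj => i; rewrite dmkK.
  + by rewrite (unsplitK (inl i)).
  + by rewrite (unsplitK (inr i)).
- by move=> v i /=; case: fintype.splitP => j ij; rewrite dmkK; congr v; apply/val_inj.
Defined.

Lemma mxvec_index_decode (m n : nat) (k : 'I_(m * n)) :
  {ij : 'I_m * 'I_n | k = mxvec_index ij.1 ij.2}.
Proof.
exists (enum_val (cast_ord (esym (mxvec_cast m n)) k)).
by rewrite /mxvec_index -surjective_pairing enum_valK cast_ordKV.
Qed.

Lemma mxvec_index_decodeK (m n : nat) (i : 'I_m) (j : 'I_n) :
  sval (mxvec_index_decode (mxvec_index i j)) = (i, j).
Proof.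
case: mxvec_index_decode => -[i' j'] /= e.
by move: e; rewrite /mxvec_index => /cast_ord_inj/enum_rank_inj ->.
Qed.

Definition fun_dtype (m : nat) (E : dtype) : dtype.
Proof.
refine (@DType ('I_m -> E) (m * ddim E)
  (fun x k => dco (x (sval (mxvec_index_decode k)).1) (sval (mxvec_index_decode k)).2)
  (fun v i => dmk (fun j => v (mxvec_index i j))) _ _).
- move=> x; apply/funext => i; apply: dco_inj => j.
  by rewrite dmkK mxvec_index_decodeK.
- move=> v k; rewrite dmkK; congr v.
  by case: mxvec_index_decode => -[i j] /= ->.
Defined.

End Coordinates.

Canonical scalar_dtype.
Canonical row_dtype.
Canonical pair_dtype.
Canonical fun_dtype.

Section RawDefinability.
Set Implicit Arguments.
Unset Strict Implicit.
Unset Printing Implicit Defensive.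
Local Open Scope classical_set_scope.
Local Open Scope ring_scope.

Variables (R : rcfType) (S : ominimal_structure R).

Lemma initE n (z : 'rV[R]_n.+1) i : init z ord0 i = z ord0 (lift ord_max i).
Proof. by rewrite /init mxE. Qed.

Lemma definableI n (A B : set 'rV[R]_n) : (0 < n)%N ->
  definable S A -> definable S B -> definable S (A `&` B).
Proof.
move=> n0 dA dB; rewrite -[A `&` B]setCK setCI.
by apply: definableC => //; apply: definableU => //; apply: definableC.
Qed.

Definition is_polynomial n (F : 'rV[R]_n -> R) :=
  exists p : mpoly.mpoly n R, forall x : 'rV[R]_n, mpoly.meval (fun i => x ord0 i) p = F x.

Lemma is_polynomial_coord n (i : 'I_n) : is_polynomial (fun x : 'rV[R]_n => x ord0 i).
Proof. by exists (mpoly.mpolyX R (mpoly.mnm1 i)) => x; rewrite mpoly.mevalXU. Qed.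

Lemma is_polynomial_const n c : @is_polynomial n (fun x => c).
Proof. by exists (mpoly.mpolyC n c) => x; rewrite mpoly.mevalC. Qed.

Lemma is_polynomialB n (F G : 'rV[R]_n -> R) :
  is_polynomial F -> is_polynomial G -> is_polynomial (fun x => F x - G x).
Proof.
by move=> [p hp] [q hq]; exists (p - q) => x; rewrite mpoly.mevalB hp hq.
Qed.

Lemma is_polynomialD n (F G : 'rV[R]_n -> R) :
  is_polynomial F -> is_polynomial G -> is_polynomial (fun x => F x + G x).
Proof.
by move=> [p hp] [q hq]; exists (p + q) => x; rewrite mpoly.mevalD hp hq.
Qed.

Lemma is_polynomialM n (F G : 'rV[R]_n -> R) :
  is_polynomial F -> is_polynomial G -> is_polynomial (fun x => F x * G x).
Proof.
by move=> [p hp] [q hq]; exists (p * q) => x; rewrite mpoly.mevalM hp hq.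
Qed.

Lemma definable_zeros n N (F : 'I_N -> 'rV[R]_n -> R) : (0 < n)%N ->
  (forall j, is_polynomial (F j)) ->
  definable S [set x | forall j, F j x = 0].
Proof.
move=> n0 /choice [p hp]; apply: definable_algebraic => //.
by exists N, p; rewrite predeqE => x; split=> h j; [rewrite hp|rewrite -hp].
Qed.

Lemma definable_project_first n N (A : set 'rV[R]_N) : (0 < n)%N -> (n <= N)%N ->
  definable S A ->
  definable S [set x : 'rV[R]_n | exists z, A z /\
     forall (i : 'I_n) (j : 'I_N), i = j :> nat -> x ord0 i = z ord0 j].
Proof.
move=> n0; elim: N A => [|N IH] A; first by rewrite leqn0 => /eqP n0'; rewrite n0' in n0.
rewrite leq_eqVlt => /orP[/eqP e|nN] dA.
  subst n; rewrite (_ : [set x | _] = A) //.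
  rewrite predeqE => x; split=> [[z [Az h]]|Ax].
    by rewrite (_ : x = z) //; apply/rowP => i; apply: h.
  by exists x; split=> // i j ij; congr (x _ _); apply: val_inj.
rewrite ltnS in nN.
have N0 : (0 < N)%N by apply: leq_trans nN.
have /(IH _ nN) := definable_proj N0 dA.
congr definable; rewrite predeqE => x; split.
  move=> [_ [[z Az <-] h]]; exists z; split=> // i j ij.
  have jN : (j < N)%N by rewrite -ij; apply: leq_trans nN.
  rewrite (h i (Ordinal jN)) // initE; congr (z _ _); apply: val_inj.
  by rewrite /= /bump leqNgt jN.
move=> [z [Az h]]; exists (init z); split; first by exists z.
move=> i j ij; rewrite initE; apply: h.
by rewrite /= /bump leqNgt ltn_ord.
Qed.

(** The set is a projection of a product cut by equations between coordinates. Substitution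
    of coordinates and projection to any coordinates are both of this form. *)
Lemma definable_relate n N q (e : 'I_q -> 'I_n * 'I_N) (A : set 'rV[R]_N) :
  (0 < n)%N -> (0 < N)%N -> definable S A ->
  definable S [set x : 'rV[R]_n | exists z, A z /\
     forall j, x ord0 (e j).1 = z ord0 (e j).2].
Proof.
move=> n0 N0 dA.
have nN : (0 < n + N)%N by rewrite addn_gt0 n0.
have dT : definable S [set: 'rV[R]_n].
  by rewrite -setC0; apply: definableC => //; apply: definable0.
have dP := definable_prod n0 N0 dT dA.
have dZ : definable S [set w : 'rV[R]_(n + N) |
    forall j, w ord0 (lshift N (e j).1) - w ord0 (rshift n (e j).2) = 0].
  apply: (definable_zeros nN) => j.
  by apply: is_polynomialB; apply: is_polynomial_coord.
have := definable_project_first n0 (leq_addr N n) (definableI nN dP dZ).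
congr definable; rewrite predeqE => x; split.
  move=> [w [[[_ Aw] /= hw] h]]; exists (rsubmx w); split=> // j.
  rewrite (h _ (lshift N (e j).1)) // [RHS]mxE.
  by apply/eqP; rewrite -subr_eq0 hw.
move=> [z [Az h]]; exists (row_mx x z); split; last first.
  move=> i j ij; rewrite (_ : j = lshift N i) ?row_mxEl //; exact: val_inj.
split=> /=; first by rewrite row_mxKr.
by move=> j; rewrite row_mxEl row_mxEr h subrr.
Qed.

Lemma definable_reindex n m (h : 'I_m -> 'I_n) (A : set 'rV[R]_m) :
  (0 < n)%N -> (0 < m)%N -> definable S A ->
  definable S [set x : 'rV[R]_n | A (\row_i x ord0 (h i))].
Proof.
move=> n0 m0 dA; have := definable_relate (fun j => (h j, j)) n0 m0 dA.
congr definable; rewrite predeqE => x; split=> /=.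
  move=> [z [Az hz]]; rewrite (_ : \row_i _ = z) //.
  by apply/rowP => i; rewrite mxE hz.
by move=> Ax; exists (\row_i x ord0 (h i)); split=> // j; rewrite mxE.
Qed.

Lemma definable_image n m (h : 'I_n -> 'I_m) (A : set 'rV[R]_m) :
  (0 < n)%N -> (0 < m)%N -> definable S A ->
  definable S [set x : 'rV[R]_n | exists z, A z /\ forall i, x ord0 i = z ord0 (h i)].
Proof.
by move=> n0 m0 dA; have := definable_relate (fun j => (j, h j)) n0 m0 dA.
Qed.

End RawDefinability.

Section Definability.
Set Implicit Arguments.
Unset Strict Implicit.
Unset Printing Implicit Defensive.
Local Open Scope classical_set_scope.
Local Open Scope ring_scope.

Variables (R : rcfType) (S : ominimal_structure R).
Implicit Types E F G : dtype R.

(** The extra coordinate makes the ambient dimension positive, so that types of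
    dimension 0 need no separate treatment. *)
Definition Def E (P : E -> Prop) : Prop :=
  definable S [set z : 'rV[R]_(ddim E).+1 | P (dmk (fun i => init z ord0 i))].

Definition Dmap E F (f : E -> F) : Prop := Def (fun z : E * F => z.2 = f z.1).

Definition lift_reindex n m (h : 'I_m -> 'I_n) (i : 'I_m.+1) : 'I_n.+1 :=
  if unlift ord_max i is Some j then lift ord_max (h j) else ord_max.

Lemma lift_reindex_lift n m (h : 'I_m -> 'I_n) j :
  lift_reindex h (lift ord_max j) = lift ord_max (h j).
Proof. by rewrite /lift_reindex liftK. Qed.

Lemma Def_ext E (P Q : E -> Prop) : (forall x, P x <-> Q x) -> Def P -> Def Q.
Proof.
by move=> PQ; congr definable; rewrite predeqE => z; apply: PQ.
Qed.

Lemma Def_reindex E F (h : 'I_(ddim F) -> 'I_(ddim E)) (P : F -> Prop) :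
  Def P -> Def (fun x : E => P (dmk (fun i => dco x (h i)))).
Proof.
move=> /(definable_reindex (lift_reindex h)) => /(_ isT isT).
congr definable; rewrite predeqE => z /=.
suff -> : (fun i => init (\row_j z ord0 (lift_reindex h j)) ord0 i) =
  (fun i => dco (dmk (fun j => init z ord0 j) : E) (h i)) by [].
by apply/funext => i; rewrite dmkK !initE mxE lift_reindex_lift.
Qed.

Lemma Def_image E F (P : E * F -> Prop) :
  Def P -> Def (fun x => exists y, P (x, y)).
Proof.
move=> /(definable_image (lift_reindex (@lshift (ddim E) (ddim F)))) => /(_ isT isT).
congr definable; rewrite predeqE => x; split=> /=.
  move=> [z [Pz h]]; exists (dmk (fun j => init z ord0 (rshift _ j))).
  rewrite (_ : (fun i => init x ord0 i) = (fun i => init z ord0 (lshift _ i))) //.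
  by apply/funext => i; rewrite !initE h lift_reindex_lift.
move=> [y Py].
pose z := \row_i (if unlift ord_max i is Some j then
  match fintype.split j with inl a => init x ord0 a | inr b => dco y b end
  else x ord0 ord_max).
have zl j : init z ord0 (lshift _ j) = init x ord0 j.
  by rewrite initE mxE liftK (unsplitK (inl j)).
have zr j : init z ord0 (rshift _ j) = dco y j.
  by rewrite initE mxE liftK (unsplitK (inr j)).
exists z; split.
  rewrite (_ : (fun j => init z ord0 (lshift _ j)) = (fun j => init x ord0 j)); last exact/funext.
  by rewrite (_ : (fun j => init z ord0 (rshift _ j)) = dco y) ?dcoK //; apply/funext.
move=> i; rewrite /lift_reindex; case: unliftP => [j ->|->].
  by rewrite -!initE zl.
by rewrite mxE unlift_none.
Qed.

Lemma Def_and E (P Q : E -> Prop) : Def P -> Def Q -> Def (fun x => P x /\ Q x).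
Proof. by move=> dP dQ; apply: definableI. Qed.

Lemma Def_or E (P Q : E -> Prop) : Def P -> Def Q -> Def (fun x => P x \/ Q x).
Proof. by move=> dP dQ; apply: definableU. Qed.

Lemma Def_not E (P : E -> Prop) : Def P -> Def (fun x => ~ P x).
Proof. by move=> dP; apply: definableC. Qed.

Lemma Def_const E (p : Prop) : Def (fun _ : E => p).
Proof.
have d0 : Def (fun _ : E => False) by apply: definable0.
have [hp|hp] := pselect p; last by apply: (Def_ext _ d0).
by apply: (Def_ext _ (Def_not d0)) => x; split=> // _.
Qed.

Lemma Def_imp E (P Q : E -> Prop) : Def P -> Def Q -> Def (fun x => P x -> Q x).
Proof.
move=> dP dQ; apply: (Def_ext _ (Def_or (Def_not dP) dQ)) => x; split.
  by case.
by move=> h; have [/h|] := pselect (P x); [right|left].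
Qed.

Lemma Def_exists E F (P : E -> F -> Prop) :
  Def (fun z : E * F => P z.1 z.2) -> Def (fun x => exists y, P x y).
Proof. by move/Def_image; apply: Def_ext. Qed.

Lemma Def_forall E F (P : E -> F -> Prop) :
  Def (fun z : E * F => P z.1 z.2) -> Def (fun x => forall y, P x y).
Proof.
move=> dP; apply: (Def_ext _ (Def_not (Def_exists (P := fun x y => ~ P x y) (Def_not dP)))).
move=> x; split=> [h y|h [y]]; last by apply; apply: h.
by apply: contrapT => nP; apply: h; exists y.
Qed.

Lemma Def_forall_seq E (I : eqType) (s : seq I) (P : I -> E -> Prop) :
  (forall i, Def (P i)) -> Def (fun x => forall i, i \in s -> P i x).
Proof.
move=> dP; elim: s => [|i s IH].
  by apply: (Def_ext _ (Def_const E True)) => x; split.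
apply: (Def_ext _ (Def_and (dP i) IH)) => x; split.
  by move=> [Pi h] j; rewrite inE => /orP[/eqP ->//|/h].
by move=> h; split=> [|j js]; apply: h; rewrite inE ?eqxx ?js ?orbT.
Qed.

Lemma Def_forall_fin E (I : finType) (P : E -> I -> Prop) :
  (forall i, Def (fun x => P x i)) -> Def (fun x => forall i, P x i).
Proof.
move=> dP; apply: (Def_ext _ (Def_forall_seq (enum I) dP)) => x; split=> h i //.
by apply: h; rewrite mem_enum.
Qed.

Lemma Def_exists_fin E (I : finType) (P : E -> I -> Prop) :
  (forall i, Def (fun x => P x i)) -> Def (fun x => exists i, P x i).
Proof.
move=> dP; have := Def_not (Def_forall_fin (P := fun x i => ~ P x i) (fun i => Def_not (dP i))).
apply: Def_ext => x; split=> [h|[i Pi] h]; last exact: (h i).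
by apply: contrapT => h'; apply: h => i Pi; apply: h'; exists i.
Qed.

Lemma Def_zero E (g : E -> R) :
  is_polynomial (fun z : 'rV[R]_(ddim E).+1 => g (dmk (fun i => init z ord0 i))) ->
  Def (fun x => g x = 0).
Proof.
move=> pg; have := @definable_zeros R S _ 1
  (fun _ (z : 'rV[R]_(ddim E).+1) => g (dmk (fun i => init z ord0 i))) isT (fun _ => pg).
by congr definable; rewrite predeqE => z; split=> /= [/(_ ord0)//|h _].
Qed.

Lemma is_polynomial_init n (i : 'I_n) :
  is_polynomial (fun z : 'rV[R]_n.+1 => init z ord0 i).
Proof.
rewrite (_ : (fun z : 'rV_n.+1 => _) = fun z => z ord0 (lift ord_max i)).
  exact: is_polynomial_coord.
by apply/funext => z; rewrite initE.
Qed.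

Lemma definable_Def n (A : set 'rV[R]_n) : (0 < n)%N ->
  definable S A <-> Def (A : 'rV[R]_n -> Prop).
Proof.
move=> n0; split.
  move=> /(definable_reindex (lift ord_max)) => /(_ isT n0).
  congr definable; rewrite predeqE => z /=.
  rewrite (_ : (\row_i z _ _) = (\row_i init z ord0 i)) //.
  by apply/rowP => i; rewrite [LHS]mxE [RHS]mxE initE.
move=> /(definable_image (lift ord_max)) => /(_ n0 isT).
congr definable; rewrite predeqE => x /=; split.
  move=> [z [Az h]]; rewrite (_ : x = \row_i init z ord0 i) //.
  by apply/rowP => i; rewrite h [RHS]mxE initE.
move=> Ax.
pose z := \row_i (if unlift ord_max i is Some j then x ord0 j else 0).
exists z; split; last by move=> i; rewrite mxE liftK.
rewrite (_ : (\row_i _) = x) //.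
by apply/rowP => i; rewrite [LHS]mxE initE mxE liftK.
Qed.

Lemma Def_scalar (P : R -> Prop) : Def P <-> definable S [set x : 'rV[R]_1 | P (x ord0 ord0)].
Proof.
rewrite definable_Def //; split.
  move=> /(@Def_reindex (row_dtype R 1) (scalar_dtype R) id); exact: Def_ext.
move=> /(@Def_reindex (scalar_dtype R) (row_dtype R 1) id).
by apply: Def_ext => x /=; rewrite mxE.
Qed.

Lemma Def_snd E F (P : F -> Prop) : Def P -> Def (fun z : E * F => P z.2).
Proof.
move=> /(@Def_reindex (pair_dtype E F) F (@rshift _ _)); apply: Def_ext => -[x y].
suff -> : dmk (fun i => dco ((x, y) : pair_dtype E F) (rshift _ i)) = y by [].
by apply: dco_inj => i; rewrite dmkK /= (unsplitK (inr i)).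
Qed.

Lemma Def_subst E F (P : F -> Prop) (f : E -> F) :
  Def P -> Dmap f -> Def (fun x => P (f x)).
Proof.
move=> dP df; have := Def_exists (P := fun x y => y = f x /\ P y)
  (Def_and df (@Def_snd E _ _ dP)).
by apply: Def_ext => x; split=> [[y [-> ]]//|h]; exists (f x).
Qed.

Lemma Dmap_coord E (i : 'I_(ddim E)) : Dmap (fun x : E => dco x i).
Proof.
have : Def (fun z : E * R => z.2 - dco z.1 i = 0).
  apply: Def_zero => /=; under eq_fun do rewrite dmkK; apply: is_polynomialB; exact: is_polynomial_init.
by apply: Def_ext => z; split=> [/eqP|->]; rewrite ?subrr // subr_eq0 => /eqP.
Qed.

Lemma Dmap_coords E F (f : E -> F) :
  (forall i, Dmap (fun x => dco (f x) i)) -> Dmap f.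
Proof.
move=> df.
have : Def (fun z : E * F => forall i, dco z.2 i = dco (f z.1) i).
  apply: Def_forall_fin => i.
  pose h (j : 'I_(ddim E + 1)) : 'I_(ddim E + ddim F) :=
    match fintype.split j with inl a => lshift _ a | inr b => rshift _ i end.
  have := Def_reindex (E := pair_dtype E F) (F := pair_dtype E (scalar_dtype R)) h (df i).
  apply: Def_ext => -[x y].
  rewrite /= /h (unsplitK (inr ord0)) /= (unsplitK (inr i)).
  rewrite (_ : dmk _ = x) //; apply: dco_inj => j.
  by rewrite dmkK (unsplitK (inl j)) (unsplitK (inl j)).
by apply: Def_ext => z; split=> [h|-> //]; apply: dco_inj.
Qed.

Lemma Dmap_ext E F (f g : E -> F) : (forall x, f x = g x) -> Dmap f -> Dmap g.
Proof. by move=> /funext ->. Qed.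

Lemma Dmap_reindex E F (h : 'I_(ddim F) -> 'I_(ddim E)) :
  Dmap (fun x : E => dmk (fun i => dco x (h i)) : F).
Proof.
by apply: Dmap_coords => i; apply: (Dmap_ext _ (Dmap_coord (h i))) => x; rewrite dmkK.
Qed.

Lemma Dmap_id E : Dmap (fun x : E => x).
Proof. exact/Dmap_coords/Dmap_coord. Qed.

Lemma Dmap_comp E F G (f : E -> F) (g : F -> G) :
  Dmap f -> Dmap g -> Dmap (fun x => g (f x)).
Proof.
move=> df dg; pose a (z : E * G) (u : F) := u = f z.1 /\ z.2 = g u.
have : Def (fun z => exists u, a z u).
  apply: Def_exists; apply: Def_and.
    apply: (Def_ext _ (Def_subst df (f := fun z : E * G * F => (z.1.1, z.2)) _)) => //.
    apply: (Dmap_ext _ (@Dmap_reindex (pair_dtype (pair_dtype E G) F) (pair_dtype E F)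
      (fun i => match fintype.split i with inl a => lshift _ (lshift _ a) | inr b => rshift _ b end))).
    move=> [[x y] u] /=; congr pair; apply: dco_inj => i; rewrite dmkK.
      by rewrite (unsplitK (inl i)) (unsplitK (inl (lshift _ i))) (unsplitK (inl i)).
    by rewrite (unsplitK (inr i)) (unsplitK (inr i)).
  apply: (Def_ext _ (Def_subst dg (f := fun z : E * G * F => (z.2, z.1.2)) _)) => //.
  apply: (Dmap_ext _ (@Dmap_reindex (pair_dtype (pair_dtype E G) F) (pair_dtype F G)
    (fun i => match fintype.split i with inl a => rshift _ a | inr b => lshift _ (rshift _ b) end))).
  move=> [[x y] u] /=; congr pair; apply: dco_inj => i; rewrite dmkK.
    by rewrite (unsplitK (inl i)) (unsplitK (inr i)).
  by rewrite (unsplitK (inr i)) (unsplitK (inl (rshift _ i))) (unsplitK (inr i)).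
apply: Def_ext => z; split=> [[u [-> ]]//|h]; by exists (f z.1).
Qed.

Lemma Dmap_pair E F G (f : E -> F) (g : E -> G) :
  Dmap f -> Dmap g -> Dmap (fun x => (f x, g x)).
Proof.
move=> df dg; apply: Dmap_coords => i /=.
case: (fintype.splitP i) => j _.
  exact: (Dmap_comp df (Dmap_coord j)).
exact: (Dmap_comp dg (Dmap_coord j)).
Qed.

Lemma Dmap_fst0 E F : Dmap (fun x : E * F => x.1).
Proof.
apply: Dmap_coords => i; apply: (Dmap_ext _ (@Dmap_coord (pair_dtype E F) (lshift _ i))).
by move=> x; rewrite /= (unsplitK (inl i)).
Qed.

Lemma Dmap_snd0 E F : Dmap (fun x : E * F => x.2).
Proof.
apply: Dmap_coords => i; apply: (Dmap_ext _ (@Dmap_coord (pair_dtype E F) (rshift _ i))).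
by move=> x; rewrite /= (unsplitK (inr i)).
Qed.

Lemma Dmap_fst E F G (f : E -> F * G) : Dmap f -> Dmap (fun x => (f x).1).
Proof. by move=> df; apply: (Dmap_comp df); apply: Dmap_fst0. Qed.

Lemma Dmap_snd E F G (f : E -> F * G) : Dmap f -> Dmap (fun x => (f x).2).
Proof. by move=> df; apply: (Dmap_comp df); apply: Dmap_snd0. Qed.

Lemma Dmap_const E F (c : F) : Dmap (fun _ : E => c).
Proof.
apply: Dmap_coords => i.
have : Def (fun z : E * R => z.2 - dco c i = 0).
  apply: Def_zero => /=; apply: is_polynomialB; last exact: is_polynomial_const.
  exact: is_polynomial_init.
by apply: Def_ext => z; split=> [/eqP|->]; rewrite ?subrr // subr_eq0 => /eqP.
Qed.

Lemma Dmap_lam E F m (f : E -> 'I_m -> F) :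
  (forall j, Dmap (fun x => f x j)) -> Dmap (fun x j => f x j).
Proof.
move=> df; apply: Dmap_coords => k /=.
exact: (Dmap_comp (df _) (Dmap_coord _)).
Qed.

(** A named application, so that a selected component of a tuple is recognised
    syntactically. *)
Definition component (X : Type) m (v : 'I_m -> X) (j : 'I_m) : X := v j.

Lemma Dmap_app E F m (f : E -> 'I_m -> F) (j : 'I_m) :
  Dmap f -> Dmap (fun x => component (f x) j).
Proof.
move=> df; apply: Dmap_coords => i.
apply: (Dmap_ext _ (Dmap_comp df (@Dmap_coord (fun_dtype m F) (mxvec_index j i)))).
by move=> x /=; rewrite mxvec_index_decodeK.
Qed.

Lemma Dmap_entry E n (f : E -> 'rV[R]_n) a j : Dmap f -> Dmap (fun x => f x a j).
Proof.
move=> df; apply: (Dmap_ext _ (Dmap_comp df (@Dmap_coord (row_dtype R n) j))).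
by move=> x; rewrite (ord1 a).
Qed.

Lemma Dmap_row E n (f : E -> 'rV[R]_n) :
  (forall j, Dmap (fun x => f x ord0 j)) -> Dmap f.
Proof. by move=> df; apply: Dmap_coords. Qed.

Lemma Dmap_add E (f g : E -> R) : Dmap f -> Dmap g -> Dmap (fun x => f x + g x).
Proof.
move=> df dg; have : Dmap (fun z : R * R => z.1 + z.2).
  have : Def (fun z : R * R * R => z.2 - (z.1.1 + z.1.2) = 0).
    apply: Def_zero => /=; do 2?apply: is_polynomialB; try exact: is_polynomial_init.
    by apply: is_polynomialD; exact: is_polynomial_init.
  by apply: Def_ext => z; split=> [/eqP|->]; rewrite ?subrr // subr_eq0 => /eqP.
exact: (Dmap_comp (Dmap_pair df dg)).
Qed.

Lemma Dmap_mul E (f g : E -> R) : Dmap f -> Dmap g -> Dmap (fun x => f x * g x).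
Proof.
move=> df dg; have : Dmap (fun z : R * R => z.1 * z.2).
  have : Def (fun z : R * R * R => z.2 - (z.1.1 * z.1.2) = 0).
    apply: Def_zero => /=; do 2?apply: is_polynomialB; try exact: is_polynomial_init.
    by apply: is_polynomialM; exact: is_polynomial_init.
  by apply: Def_ext => z; split=> [/eqP|->]; rewrite ?subrr // subr_eq0 => /eqP.
exact: (Dmap_comp (Dmap_pair df dg)).
Qed.

Lemma Dmap_opp E (f : E -> R) : Dmap f -> Dmap (fun x => - f x).
Proof.
move=> df; apply: (Dmap_ext _ (Dmap_mul (Dmap_const E (-1 : scalar_dtype R)) df)).
by move=> x; rewrite mulN1r.
Qed.

Lemma Def_eq E F (f g : E -> F) : Dmap f -> Dmap g -> Def (fun x => f x = g x).
Proof.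
move=> df dg; exact: (Def_subst (Dmap_id F) (Dmap_pair dg df)).
Qed.

Lemma Def_pos : Def (fun x : R => 0 < x).
Proof.
apply/Def_scalar/definable1P.
exists [set open_interval (0%:E)%E +oo%E]; split; first exact: finite_set1.
  by move=> _ ->; right; exists 0%:E%E, +oo%E; rewrite ltry.
rewrite predeqE => x /=; rewrite bigcup_set1 /open_interval /= lte_fin ltry.
by split=> [->|[]].
Qed.

Lemma Def_lt E (f g : E -> R) : Dmap f -> Dmap g -> Def (fun x => f x < g x).
Proof.
move=> df dg; apply: (Def_ext _ (Def_subst Def_pos (Dmap_add dg (Dmap_opp df)))).
by move=> x; rewrite subr_gt0.
Qed.

Lemma Def_le E (f g : E -> R) : Dmap f -> Dmap g -> Def (fun x => f x <= g x).
Proof.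
move=> df dg; apply: (Def_ext _ (Def_not (Def_lt dg df))).
by move=> x; rewrite leNgt; split => /negP.
Qed.

Lemma Dmap_abs E (f : E -> R) : Dmap f -> Dmap (fun x => `|f x|).
Proof.
move=> df; have : Dmap (fun x : R => `|x|).
  have : Def (fun z : R * R => (0 <= z.1 /\ z.2 = z.1) \/ (z.1 < 0 /\ z.2 = - z.1)).
    have d1 : Dmap (fun z : R * R => z.1) by apply: Dmap_fst0.
    have d2 : Dmap (fun z : R * R => z.2) by apply: Dmap_snd0.
    have d0 : Dmap (fun z : R * R => 0 : R) by apply: Dmap_const.
    exact: (Def_or (Def_and (Def_le d0 d1) (Def_eq d2 d1))
      (Def_and (Def_lt d1 d0) (Def_eq d2 (Dmap_opp d1)))).
  apply: Def_ext => z; split.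
    by move=> [[h ->]|[h ->]]; [rewrite ger0_norm|rewrite ltr0_norm].
  move=> ->; have [h|h] := leP 0 z.1; [left|right]; split=> //.
    by rewrite ger0_norm.
  by rewrite ltr0_norm.
exact: (Dmap_comp df).
Qed.

End Definability.

(** Extended below for predicates and operations introduced later. *)
Ltac def_more := fail.

(** Proves definability goals by recursion on the first-order formula and on the
    terms occurring in it. *)
Ltac def_step :=
  cbv beta;
  lazymatch goal with
  | |- Def _ (fun _ => ?p) => refine (Def_const _ _ p)
  | |- Def _ (fun z => @?P z /\ @?Q z) => refine (@Def_and _ _ _ P Q _ _)
  | |- Def _ (fun z => @?P z \/ @?Q z) => refine (@Def_or _ _ _ P Q _ _)
  | |- Def _ (fun z => ~ @?P z) => refine (@Def_not _ _ _ P _)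
  | |- Def _ (fun z => @?P z -> @?Q z) => refine (@Def_imp _ _ _ P Q _ _)
  | |- Def _ (fun z => @?P z <-> @?Q z) =>
      refine (@Def_and _ _ _ (fun z => P z -> Q z) (fun z => Q z -> P z) _ _)
  | |- Def _ (fun z => forall y, @?P z y) =>
      first [refine (@Def_forall _ _ _ _ P _) | refine (@Def_forall_fin _ _ _ _ P _); intro]
  | |- Def _ (fun z => exists y, @?P z y) =>
      first [refine (@Def_exists _ _ _ _ P _) | refine (@Def_exists_fin _ _ _ _ P _); intro]
  | |- Def _ (fun z => (@?f z < @?g z)%R = true) => refine (@Def_lt _ _ _ f g _ _)
  | |- Def _ (fun z => is_true (@?f z < @?g z)%R) => refine (@Def_lt _ _ _ f g _ _)
  | |- Def _ (fun z => is_true (@?f z <= @?g z)%R) => refine (@Def_le _ _ _ f g _ _)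
  | |- Def _ (fun z => @?f z = @?g z) => refine (@Def_eq _ _ _ _ f g _ _)
  | H : Def _ ?X |- Def _ (fun z => ?X (@?f z)) => refine (@Def_subst _ _ _ _ X f H _)
  | H : Def _ ?X |- Def _ ?X => exact H
  | H : forall i, Def _ (?X i) |- Def _ (fun z => ?X ?i (@?f z)) =>
      refine (@Def_subst _ _ _ _ (X i) f (H i) _)
  | |- Dmap _ (fun z => z) => apply: Dmap_id
  | |- Dmap _ (fun _ => ?c) => refine (Dmap_const _ _ c)
  | |- Dmap _ (fun z => fst (@?f z)) => refine (@Dmap_fst _ _ _ _ _ f _)
  | |- Dmap _ (fun z => snd (@?f z)) => refine (@Dmap_snd _ _ _ _ _ f _)
  | |- Dmap _ fst => apply: Dmap_fst0
  | |- Dmap _ snd => apply: Dmap_snd0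
  | |- Dmap _ (fun z => (@?f z, @?g z)) => refine (@Dmap_pair _ _ _ _ _ f g _ _)
  | |- Dmap _ (fun z => @?f z + @?g z)%R => refine (@Dmap_add _ _ _ f g _ _)
  | |- Dmap _ (fun z => @?f z * @?g z)%R => refine (@Dmap_mul _ _ _ f g _ _)
  | |- Dmap _ (fun z => - @?f z)%R => refine (@Dmap_opp _ _ _ f _)
  | |- Dmap _ (fun z => Num.norm (@?f z)) => refine (@Dmap_abs _ _ _ f _)
  | |- Dmap _ (fun z => @?f z *+ 2)%R => refine (@Dmap_add _ _ _ f f _ _)
  | |- Dmap _ (fun z => fun_of_matrix (@?f z) ?a ?j) =>
      refine (@Dmap_entry _ _ _ _ f a j _)
  | H : Dmap _ ?F |- Dmap _ (fun z => ?F (@?f z)) => refine (@Dmap_comp _ _ _ _ _ f F _ H)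
  | H : Dmap _ ?F |- Dmap _ ?F => exact H
  | H : forall i, Dmap _ (?F i) |- Dmap _ (fun z => ?F ?i (@?f z)) =>
      refine (@Dmap_comp _ _ _ _ _ f (F i) _ (H i))
  | |- Dmap _ (fun z => (fun j => @?f z j)) => refine (@Dmap_lam _ _ _ _ _ f _); intro
  | |- Dmap _ (fun z => component (@?f z) ?j) => refine (@Dmap_app _ _ _ _ _ f j _)
  end.
Ltac def_auto := repeat (first [progress def_more | def_step]).

(** * Definable sets and functions of one variable *)

Section OneVariable.
Set Implicit Arguments.
Unset Strict Implicit.
Unset Printing Implicit Defensive.
Local Open Scope classical_set_scope.
Local Open Scope ring_scope.

Variables (R : rcfType) (S : ominimal_structure R).
Implicit Types E F : dtype R.

(** Finite unions of points and intervals, encoded by a list of points at which alone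
    membership may change; for unions one concatenates the lists. *)
Definition tame (P : R -> Prop) := exists s : seq R, forall x y, x < y ->
  (forall z, z \in s -> ~ (x <= z /\ z <= y)) -> (P x <-> P y).

Lemma tame_or (P Q : R -> Prop) : tame P -> tame Q -> tame (fun x => P x \/ Q x).
Proof.
move=> [s hs] [t ht]; exists (s ++ t) => x y xy h.
have h1 : P x <-> P y by apply: hs => // z zs; apply: h; rewrite mem_cat zs.
have h2 : Q x <-> Q y by apply: ht => // z zs; apply: h; rewrite mem_cat zs orbT.
by rewrite h1 h2.
Qed.

Lemma tame_point_or_open_interval (I : set R) : point_or_open_interval I -> tame I.
Proof.
move=> [[a ->]|[a [b [ab ->]]]].
  exists [:: a] => x y xy /(_ a); rewrite mem_seq1 eqxx => /(_ isT) h /=.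
  by split=> e; exfalso; apply: h; subst; rewrite lexx (ltW xy).
exists [:: fine a; fine b] => x y xy h; rewrite /open_interval /=.
have ha := h (fine a); have hb := h (fine b).
rewrite !inE !eqxx ?orbT in ha hb.
have {}ha := ha isT; have {}hb := hb isT.
have -> : (a < x%:E)%E <-> (a < y%:E)%E.
  case: a {ab h hb} ha => [a| |] //= ha; rewrite ?lte_fin //.
    split=> h; first by lra.
    by case: (ltP a x) => // ax; exfalso; apply: ha; lra.
  by rewrite !ltNyr.
have -> // : (x%:E < b)%E <-> (y%:E < b)%E.
case: b {ab h ha} hb => [b| |] //= hb; rewrite ?lte_fin //.
  split=> h; last by lra.
  by case: (ltP y b) => // ax; exfalso; apply: hb; lra.
by rewrite !ltry.
Qed.

Lemma Def_tame (P : R -> Prop) : Def S P -> tame P.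
Proof.
move=> /Def_scalar/definable1P[F [/finite_seqP[s ->] FI FE]].
have {FE} PE x : P x <-> exists I, I \in s /\ I x.
  have : [set x : 'rV[R]_1 | P (x ord0 ord0)] (\row__ x) <->
    [set x0 : 'rV_1 | (\bigcup_(I in [set` s]) I) (x0 ord0 ord0)] (\row__ x) by rewrite FE.
  rewrite /= mxE => ->; split=> [[I Is Ix]|[I [Is Ix]]]; by exists I.
have {}FI I : I \in s -> point_or_open_interval I by apply: FI.
suff : tame (fun x => exists I, I \in s /\ I x).
  by move=> [t ht]; exists t => x y xy /(ht _ _ xy); rewrite !PE.
elim: s FI {PE} => [|I s IH] FI.
  by exists [::] => x y _ _; split=> -[I []].
have tI := tame_point_or_open_interval (FI I (mem_head _ _)).
have ts : tame (fun x => exists I, I \in s /\ I x).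
  by apply: IH => J Js; apply: FI; rewrite inE Js orbT.
have [t ht] := tame_or tI ts; exists t => x y xy /(ht _ _ xy) {}ht.
have e z : (exists J, J \in I :: s /\ J z) <-> (I z \/ exists J, J \in s /\ J z).
  split=> [[J []]|[Iz|[J [Js Jz]]]].
  - by rewrite inE => /orP[/eqP ->|Js Jz]; [left|right; exists J].
  - by exists I; rewrite mem_head.
  - by exists J; rewrite inE Js orbT.
by rewrite !e.
Qed.

Lemma next_in_seq (s : seq R) (a : R) : (forall z, z \in s -> z <= a) \/
  exists z0, [/\ z0 \in s, a < z0 & forall z, z \in s -> a < z -> z0 <= z].
Proof.
elim: s => [|x s [IH|[z0 [z0s az0 IH]]]]; first by left.
- have [xa|ax] := leP x a; [left|right; exists x; split=> //].
  + by move=> z; rewrite inE => /orP[/eqP ->|/IH].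
  + by rewrite mem_head.
  + move=> z; rewrite inE => /orP[/eqP -> //|/IH]; lra.
- right; have [ax|xa] := ltP a x; last first.
    exists z0; split=> //; first by rewrite inE z0s orbT.
    move=> z; rewrite inE => /orP[/eqP ->|/IH//]; lra.
  have [xz|zx] := leP x z0.
    exists x; split=> //; first by rewrite mem_head.
    by move=> z; rewrite inE => /orP[/eqP -> //|/IH h /h]; lra.
  exists z0; split=> //; first by rewrite inE z0s orbT.
  by move=> z; rewrite inE => /orP[/eqP -> //|/IH h /h]; lra.
Qed.

Lemma seq_free_right (s : seq R) (a : R) :
  exists b, a < b /\ forall z, z \in s -> a < z -> b <= z.
Proof.
have [h|[z [_ az h]]] := next_in_seq s a; last by exists z.
by exists (a + 1); split=> [|z /h]; lra.
Qed.

Lemma pos_below_seq (s : seq R) : exists c, 0 < c /\ forall z, z \in s -> 0 < z -> c < z.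
Proof.
have [b [b0 h]] := seq_free_right s 0; exists (b / 2); split; first by lra.
by move=> z /h{}h /h; lra.
Qed.

Lemma interval_not_seq (s : seq R) (a b : R) : a < b ->
  ~ (forall x, a < x -> x < b -> x \in s).
Proof.
move=> ab h; have [c [ac hc]] := seq_free_right s a.
have [bc|cb] := leP b c.
  by have := hc ((a + b) / 2); rewrite h //; lra.
by have := hc ((a + c) / 2); rewrite h //; lra.
Qed.

Lemma germ_right (P : R -> Prop) (a : R) : Def S P -> exists b, a < b /\
  ((forall x, a < x -> x < b -> P x) \/ (forall x, a < x -> x < b -> ~ P x)).
Proof.
move=> /Def_tame[s hs]; have [b [ab hb]] := seq_free_right s a.
exists b; split=> //.
have const x y : a < x -> x < b -> a < y -> y < b -> P x -> P y.
  move=> ax xb ay yb.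
  have [xy|yx|-> //] := ltgtP x y.
    by move=> Px; apply/(hs x y xy) => // z /hb h [? ?]; have := h; lra.
  by move=> Px; apply/(hs y x yx) => // z /hb h [? ?]; have := h; lra.
have [Pm|nPm] := pselect (P ((a + b) / 2)); [left|right] => x ax xb.
  by apply: const Pm; lra.
by move=> Px; apply: nPm; apply: const Px; lra.
Qed.

Definition fin (P : R -> Prop) := exists s : seq R, forall x, P x -> x \in s.

Lemma fin_or_interval (P : R -> Prop) : Def S P -> fin P \/
  exists a b, a < b /\ forall x, a < x -> x < b -> P x.
Proof.
move=> /Def_tame[s hs].
have [h|h] := pselect (forall x, P x -> x \in s); first by left; exists s.
right; have [x [Px xs]] : exists x, P x /\ x \notin s.
  apply: contrapT => h'; apply: h => x Px; apply: contrapT => /negP xs.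
  by apply: h'; exists x.
have [b [xb hb]] := seq_free_right s x; exists x, b; split=> // y xy yb.
apply/(hs x y xy) => // z zs [xz zy].
have xz' : x < z by rewrite lt_neqAle xz andbT; apply: contraNneq xs => ->.
by have := hb z zs xz'; lra.
Qed.

Definition is_glb (P : R -> Prop) (m : R) :=
  (forall x, P x -> m <= x) /\ (forall l, (forall x, P x -> l <= x) -> l <= m).

(** The field need not be complete. The greatest lower bound is found among finitely many
    candidates: [l] and the points where membership in [P] changes. *)
Lemma glb_exists (P : R -> Prop) (l : R) : Def S P -> (exists x, P x) ->
  (forall x, P x -> l <= x) -> exists m, is_glb P m.
Proof.
move=> /Def_tame[s hs] [x0 Px0] hl.
pose L t := forall x, P x -> t <= x.
have [m [Lm hm]] : exists m, L m /\ forall z, z \in s -> L z -> z <= m.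
  elim: s {hs} => [|z s [m [Lm IH]]]; first by exists l.
  have [[Lz zm]|h] := pselect (L z /\ m < z).
    exists z; split=> // y; rewrite inE => /orP[/eqP -> //|/IH h /h]; lra.
  exists m; split=> // y; rewrite inE => /orP[/eqP -> Lz|/IH//].
  by rewrite leNgt; apply/negP => zm; apply: h.
exists m; split=> // t Lt; rewrite leNgt; apply/negP => mt.
have [x1 [Px1 hx1]] : exists x1, P x1 /\ forall z, z \in s -> m < z -> x1 < z.
  have [h|[z0 [z0s mz0 hz0]]] := next_in_seq s m.
    by exists x0; split=> // z /h; lra.
  have [x1 [Px1 x1z]] : exists x1, P x1 /\ x1 < z0.
    apply: contrapT => h; suff /(hm _ z0s) : L z0 by lra.
    move=> x Px; rewrite leNgt; apply/negP => xz; apply: h; by exists x.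
  by exists x1; split=> // z /hz0 h /h; lra.
have tx1 := Lt _ Px1.
suff /Lt : P ((m + t) / 2) by lra.
apply/(hs _ x1); [lra | | done].
by move=> z /hx1 h [? ?]; have := h; lra.
Qed.

(** Outside the domain of the relation the function takes an arbitrary constant value. *)
Lemma Dmap_unique E F (G : E * F -> Prop) : Def S G ->
  (forall x y y', G (x, y) -> G (x, y') -> y = y') ->
  exists f : E -> F, Dmap S f /\ forall x y, G (x, y) -> f x = y.
Proof.
move=> dG uG; pose y0 : F := dmk (fun _ => 0).
have ex x : exists y, G (x, y) \/ ((forall y, ~ G (x, y)) /\ y = y0).
  have [[y Gy]|h] := pselect (exists y, G (x, y)); first by exists y; left.
  by exists y0; right; split=> // y Gy; apply: h; exists y.
have [f hf] := choice ex.
exists f; split; last first.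
  by move=> x y Gy; case: (hf x) => [Gf|[/(_ y)//]]; apply: uG Gf Gy.
have : Def S (fun z : E * F => G (z.1, z.2) \/ ((forall y, ~ G (z.1, y)) /\ z.2 = y0)).
  by def_auto.
apply: Def_ext => -[x y] /=; split; last by move->; apply: hf.
move=> [Gy|[h ->]]; case: (hf x) => //.
- by move=> Gf; apply: uG Gy Gf.
- by move=> [/(_ y)].
- by move=> Gf; have := h _ Gf.
- by case=> _ ->.
Qed.

Lemma Dmap_if E F (P : E -> Prop) (f g : E -> F) : Def S P -> Dmap S f -> Dmap S g ->
  Dmap S (fun x => if `[<P x>] then f x else g x).
Proof.
move=> dP df dg.
have : Def S (fun z : E * F => (P z.1 /\ z.2 = f z.1) \/ (~ P z.1 /\ z.2 = g z.1)).
  by def_auto.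
apply: Def_ext => -[x y] /=; case: asboolP => Px; split.
- by case=> -[].
- by left.
- by case=> -[].
- by right.
Qed.

Lemma definable_glb E (A : E * R -> Prop) : Def S A -> exists f : E -> R, Dmap S f /\
  forall x l, (exists t, A (x, t)) -> (forall t, A (x, t) -> l <= t) ->
    is_glb (fun t => A (x, t)) (f x).
Proof.
move=> dA; pose G (z : E * R) := is_glb (fun t => A (z.1, t)) z.2.
have dG : Def S G by rewrite /G /is_glb; def_auto.
have [f [df hf]] : exists f : E -> R, Dmap S f /\ forall x y, G (x, y) -> f x = y.
  apply: Dmap_unique => // x y y' [/= h1 h2] [/= h3 h4].
  by apply/eqP; rewrite eq_le h4 // h2.
exists f; split=> // x l ne lb.
have dAx : Def S (fun t => A (x, t)) by def_auto.
have [m hm] := glb_exists dAx ne lb.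
by rewrite (hf x m).
Qed.

(** If the greatest lower bound [d] of a fibre does not belong to it, then the fibre contains
    an interval with left end [d]; take the midpoint of the longest one of length at most 1. *)
Lemma definable_choice_ge0 E (A : E * R -> Prop) : Def S A ->
  (forall x t, A (x, t) -> 0 <= t) -> exists f : E -> R, Dmap S f /\
  forall x, (exists t, A (x, t)) -> A (x, f x).
Proof.
move=> dA A0; have [d [dd hd]] := definable_glb dA.
pose B (z : E * R) := d z.1 < z.2 /\ (d z.1 + 1 < z.2 \/ ~ A z).
have dB : Def S B by rewrite /B; def_auto.
have [b [db hb]] := definable_glb dB.
exists (fun x => if `[<A (x, d x)>] then d x else 2^-1 * (d x + b x)); split.
  by apply: Dmap_if => //; def_auto.
move=> x ne; case: asboolP => // nAd.
have [d1 d2] := hd x 0 ne (A0 x).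
have [b1 b2] : is_glb (fun t => B (x, t)) (b x).
  apply: (hb x (d x)); first by exists (d x + 2); split; [|left]; rewrite /=; lra.
  by move=> t [/= + _]; lra.
have dAx : Def S (fun t => A (x, t)) by def_auto.
have [c [dc hc]] := germ_right (d x) dAx.
have {}hc : forall t, d x < t -> t < c -> A (x, t).
  case: hc => // hc; exfalso.
  suff : c <= d x by lra.
  apply: d2 => t At; rewrite leNgt; apply/negP => tc.
  have := d1 _ At; rewrite le_eqVlt => /orP[/eqP e|dt]; first by rewrite e in nAd.
  exact: hc At.
have dbx : d x < b x.
  have [c1|c1] := ltP c (d x + 1); last first.
    suff : d x + 1 <= b x by lra.
    by apply: b2 => t [/= ? [|]]; [lra | rewrite leNgt => nA; apply/negP => ?; apply: nA; apply: hc; lra].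
  suff : c <= b x by lra.
  by apply: b2 => t [/= ? [|]]; [lra | rewrite leNgt => nA; apply/negP => ?; apply: nA; apply: hc; lra].
apply: contrapT => nA.
suff : b x <= 2^-1 * (d x + b x) by lra.
by apply: b1; split; [rewrite /=; lra|right].
Qed.

Lemma definable_choice E (A : E * R -> Prop) : Def S A -> exists f : E -> R, Dmap S f /\
  forall x, (exists t, A (x, t)) -> A (x, f x).
Proof.
move=> dA.
have dP : Def S (fun z : E * R => 0 <= z.2 /\ A z) by def_auto.
have dN : Def S (fun z : E * R => 0 <= z.2 /\ A (z.1, - z.2)) by def_auto.
have [f [df hf]] := definable_choice_ge0 dP (fun x t (h : _ /\ _) => proj1 h).
have [g [dg hg]] := definable_choice_ge0 dN (fun x t (h : _ /\ _) => proj1 h).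
exists (fun x => if `[<exists t, 0 <= t /\ A (x, t)>] then f x else - g x); split.
  by apply: Dmap_if; def_auto.
move=> x [t At]; case: asboolP => h; first by case: (hf x h).
apply: (proj2 (hg x _)); exists (- t); rewrite /= opprK; split=> //.
rewrite oppr_ge0 leNgt; apply/negP => t0; apply: h; exists t; split=> //; exact: ltW.
Qed.

Lemma fin_image (P : R -> Prop) (f : R -> R) : fin (fun y => exists x, P x /\ y = f x) ->
  (forall x y, P x -> P y -> f x = f y -> x = y) -> fin P.
Proof.
move=> [s hs] injf.
have /choice[h hh] : forall y, exists x, (exists x, P x /\ y = f x) -> P x /\ y = f x.
  move=> y; have [[x hx]|n] := pselect (exists x, P x /\ y = f x); first by exists x.
  by exists 0.
exists (map h s) => x Px.
have [Ph e] : P (h (f x)) /\ f x = f (h (f x)) by apply: hh; exists x.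
by rewrite (injf _ _ Px Ph e); apply: map_f; apply: hs; exists x.
Qed.

(** Choose a radius definably. If its range is finite, it is bounded below by
    a positive constant; otherwise the range contains an interval, so that the
    radius exceeds some positive constant infinitely often. *)
Lemma uniform_radius (Q : R * R -> Prop) (a b : R) : Def S Q -> a < b ->
  (forall x, a < x -> x < b -> exists e : R, 0 < e /\ Q (x, e)) ->
  (forall x e e' : R, Q (x, e) -> 0 < e' -> e' <= e -> Q (x, e')) ->
  exists a' b' e : R, [/\ a' < b', 0 < e &
    forall x, a' < x -> x < b' -> [/\ a < x, x < b & Q (x, e)]].
Proof.
move=> dQ ab ex her.
have dA : Def S (fun z : R * R => 0 < z.2 /\ Q z) by def_auto.
have [f [df hf]] := definable_choice dA.
have {hf} [f0 fQ] : (forall x, a < x -> x < b -> 0 < f x) /\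
    (forall x, a < x -> x < b -> Q (x, f x)).
  by split=> x ax xb; have [] := hf x (ex x ax xb).
have dI : Def S (fun y => exists x, (a < x /\ x < b) /\ y = f x) by def_auto.
have [[s hs]|[u [v [uv huv]]]] := fin_or_interval dI.
  have [c [c0 hc]] := pos_below_seq s.
  exists a, b, c; split=> // x ax xb; split=> //; apply: her (fQ _ ax xb) c0 _.
  by apply/ltW/hc; [apply: hs; exists x | apply: f0].
have [c0 cv] : 0 < (u + v) / 2 /\ (u + v) / 2 < v.
  split; last by lra.
  by have [|| x [[ax xb] ->]] := huv ((u + v) / 2); [lra|lra|apply: f0].
move: ((u + v) / 2) c0 cv => c c0 cv.
have dK : Def S (fun x => (a < x /\ x < b) /\ c < f x) by def_auto.
have [[s hs]|[a' [b' [ab' hab]]]] := fin_or_interval dK; last first.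
  exists a', b', c; split=> // x ax xb; have [[ax' xb'] cf] := hab x ax xb.
  by split=> //; apply: her (fQ _ ax' xb') c0 (ltW cf).
exfalso; have [m mE] : exists m, m = Num.max u c by exists (Num.max u c).
apply: (@interval_not_seq (map f s) m v); first by rewrite mE gt_max uv cv.
move=> y my yv.
have [uy cy] : u < y /\ c < y by rewrite mE gt_max in my; move/andP: my.
have [x [[ax xb] e]] := huv y uy yv.
by rewrite e; apply: map_f; apply: hs; rewrite -e.
Qed.

Definition cont1 (f : R -> R) (x : R) :=
  forall e : R, 0 < e -> exists d : R, 0 < d /\ forall y : R, `|y - x| < d -> `|f y - f x| < e.

(** The range contains an interval, and an increasing function onto an interval is
    continuous. *)
Lemma increasing_cont1 (f : R -> R) (a b : R) : Dmap S f -> a < b ->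
  (forall x y, a < x -> x < y -> y < b -> f x < f y) ->
  exists a' b', a' < b' /\ forall x, a' < x -> x < b' -> [/\ a < x, x < b & cont1 f x].
Proof.
move=> df ab mf.
have dI : Def S (fun y => exists x, (a < x /\ x < b) /\ y = f x) by def_auto.
have [/fin_image h|[u [v [uv huv]]]] := fin_or_interval dI.
  exfalso; have [|s hs] := h.
    move=> x y [ax xb] [ay yb] e; have [xy|yx|//] := ltgtP x y.
      by have := mf _ _ ax xy yb; lra.
    by have := mf _ _ ay yx xb; lra.
  by apply: (@interval_not_seq s a b ab) => x ax xb; apply: hs.
have refl x y : a < x -> x < b -> a < y -> y < b -> f x < f y -> x < y.
  move=> ax xb ay yb fxy; have [//|yx|e] := ltgtP x y; last by subst; lra.
  by have := mf _ _ ay yx xb; lra.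
have [||c [[ac cb] ce]] := huv ((3 * u + v) / 4); [lra|lra|].
have [||d [[ad db] de]] := huv ((u + 3 * v) / 4); [lra|lra|].
exists c, d; split; first by apply: refl => //; lra.
move=> x cx xd; split; [lra|lra|] => e e0.
have c1 := mf _ _ ac cx (lt_trans xd db); have d1 := mf _ _ (lt_trans ac cx) xd db.
have [c' [cc' c'x fc']] : exists c', [/\ a < c', c' < x & f x - e < f c'].
  have [h|h] := ltP (f x - e) (f c); first by exists c.
  have [||c' [[ac' cb'] ce']] := huv (f x - e / 2); [lra|lra|].
  exists c'; split=> //; last by lra.
  by apply: refl => //; lra.
have [d' [dd' d'x fd']] : exists d', [/\ d' < b, x < d' & f d' < f x + e].
  have [h|h] := ltP (f d) (f x + e); first by exists d.
  have [||d' [[ac' cb'] ce']] := huv (f x + e / 2); [lra|lra|].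
  exists d'; split=> //; last by lra.
  by apply: refl => //; lra.
exists (Num.min (x - c') (d' - x)); split; first by rewrite lt_min; apply/andP; lra.
move=> y; rewrite lt_min => /andP[]; rewrite !ltr_norml => /andP[? ?] /andP[? ?].
have fy1 : f c' < f y by apply: mf; lra.
have fy2 : f y < f d' by apply: mf; lra.
by apply/andP; lra.
Qed.

Definition mono_up (f : R -> R) (a b : R) :=
  forall x y, a < x -> x <= y -> y < b -> f x <= f y.

Lemma cont1N (f : R -> R) x : cont1 (fun y => - f y) x -> cont1 f x.
Proof.
move=> h e /h[d [d0 hd]]; exists d; split=> // y /hd.
by rewrite -opprD normrN.
Qed.

(** Immediately to the right of any point [x], the values of [f] are all larger than [f x], all
    equal to it or all smaller. On a subinterval the same case occurs everywhere with a
    uniform radius; where the length is below that radius, [f] is increasing,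
    constant or decreasing. *)
Lemma locally_monotone (f : R -> R) (a b : R) : Dmap S f -> a < b ->
  exists a' b', [/\ a' < b', forall x, a' < x -> x < b' -> [/\ a < x, x < b & cont1 f x] &
    mono_up f a' b' \/ mono_up (fun x => - f x) a' b'].
Proof.
move=> df ab.
have key (r : R -> R -> Prop) (a0 b0 : R) : Def S (fun z : R * R => r z.1 z.2) -> a0 < b0 ->
    (forall x, a0 < x -> x < b0 -> exists e : R, 0 < e /\ forall y, x < y -> y < x + e -> r (f x) (f y)) ->
    exists a' b', [/\ a' < b', forall x, a' < x -> x < b' -> a0 < x /\ x < b0 &
      forall x y, a' < x -> x < y -> y < b' -> r (f x) (f y)].
  move=> dr ab0 h.
  pose Q (z : R * R) := forall y, z.1 < y -> y < z.1 + z.2 -> r (f z.1) (f y).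
  have dQ : Def S Q.
    pose r' (z : R * R) := r z.1 z.2.
    have e : Q = fun z => forall y, z.1 < y -> y < z.1 + z.2 -> r' (f z.1, f y) by [].
    by rewrite e; change (Def S r') in dr; clearbody r'; def_auto.
  have [|a' [b' [e [ab' e0 hQ]]]] := uniform_radius dQ ab0 h.
    by move=> x e e' h1 e0 ee y xy ye; apply: h1 => //=; rewrite /= in xy ye *; lra.
  exists a', (Num.min b' (a' + e)); split.
  - by rewrite lt_min ab' /=; lra.
  - by move=> x ax; rewrite lt_min => /andP[xb _]; have [] := hQ x ax xb.
  - move=> x y ax xy; rewrite lt_min => /andP[yb ye].
    have [|_ _] := hQ x ax; first by lra.
    by apply => //=; lra.
pose P1 (x : R) := exists e : R, 0 < e /\ forall y : R, x < y -> y < x + e -> f x < f y.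
pose P2 (x : R) := exists e : R, 0 < e /\ forall y : R, x < y -> y < x + e -> f x = f y.
pose P3 (x : R) := exists e : R, 0 < e /\ forall y : R, x < y -> y < x + e -> - f x < - f y.
have P123 x : P1 x \/ P2 x \/ P3 x.
  have d1 : Def S (fun y => f x < f y) by def_auto.
  have d2 : Def S (fun y => f x = f y) by def_auto.
  have [c [xc [h|h]]] := germ_right x d1.
    by left; exists (c - x); split=> [|y xy yc]; [lra|apply: h; lra].
  have [c' [xc' [h'|h']]] := germ_right x d2.
    by right; left; exists (c' - x); split=> [|y xy yc]; [lra|apply: h'; lra].
  right; right; exists (Num.min (c - x) (c' - x)); split.
    by rewrite lt_min; apply/andP; lra.
  move=> y xy; rewrite -ltrBlDl lt_min => /andP[yc yc'].
  have n1 : f x <> f y by apply: h'; lra.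
  have n2 : ~ f x < f y by apply: h; lra.
  by rewrite ltrN2; case: (ltgtP (f x) (f y)) => // e; case: n1.
have incr (g : R -> R) (a0 b0 : R) : Dmap S g -> a <= a0 -> a0 < b0 -> b0 <= b ->
    (forall x y, a0 < x -> x < y -> y < b0 -> g x < g y) ->
    exists a' b', [/\ a' < b', forall x, a' < x -> x < b' -> [/\ a < x, x < b & cont1 g x] &
    mono_up g a' b'].
  move=> dg aa0 ab0 bb0 hg; have [a' [b' [ab' h]]] := increasing_cont1 dg ab0 hg.
  exists a', b'; split=> //.
    by move=> x ax xb; have [] := h x ax xb; split=> //; lra.
  move=> x y ax; rewrite le_eqVlt => /orP[/eqP -> //|xy] yb; apply/ltW/hg => //.
    by have [|] := h x ax; lra.
  by have [|] := h y _ yb; lra.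
have dP1 : Def S P1 by rewrite /P1; def_auto.
have dP2 : Def S P2 by rewrite /P2; def_auto.
have inside (a1 b1 : R) : a1 < b1 -> (forall x, a1 < x -> x < b1 -> a < x /\ x < b) ->
    a <= a1 /\ b1 <= b.
  move=> ab1 h; split; rewrite leNgt; apply/negP => h'.
    have [m [m1 m2 m3]] : exists m, [/\ a1 < m, m < b1 & m < a].
      have [l|l] := ltP a b1; first by exists ((a1 + a) / 2); split; lra.
      by exists ((a1 + b1) / 2); split; lra.
    by have := h m m1 m2; lra.
  have [m [m1 m2 m3]] : exists m, [/\ a1 < m, m < b1 & b < m].
    have [l|l] := ltP a1 b; first by exists ((b1 + b) / 2); split; lra.
    by exists ((a1 + b1) / 2); split; lra.
  by have := h m m1 m2; lra.
have [b1 [ab1 h1]] := germ_right a dP1.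
have [b2 [ab2 h2]] := germ_right a dP2.
have [c [ac cb cb1 cb2]] : exists c, [/\ a < c, c <= b, c <= b1 & c <= b2].
  exists (Num.min b (Num.min b1 b2)); rewrite !lt_min !ge_min !lexx ab ab1 ab2 ?orbT; split=> //.
have dlt : Def S (fun z : R * R => z.1 < z.2) by def_auto.
have deq : Def S (fun z : R * R => z.1 = z.2) by def_auto.
have dgt : Def S (fun z : R * R => - z.1 < - z.2) by def_auto.
case: h1 => h1.
  have [|a' [b' [ab' hin hm]]] := key (fun u v => u < v) _ _ dlt ac.
    by move=> x ax xb; apply: h1; lra.
  have [] := inside a' b' ab'; first by move=> x /hin h /h; lra.
  move=> aa' bb'; have [a'' [b'' [h3 h4 h5]]] := incr f a' b' df aa' ab' bb' hm.
  by exists a'', b''; split=> //; left.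
case: h2 => h2.
  have [|a' [b' [ab' hin hm]]] := key (fun u v => u = v) _ _ deq ac.
    by move=> x ax xb; apply: h2; lra.
  exists a', b'; split=> //; last first.
    left=> x y ax; rewrite le_eqVlt => /orP[/eqP -> //|xy] yb.
    by rewrite (hm x y).
  move=> x ax xb; split; [by have := hin x ax xb; lra|by have := hin x ax xb; lra|].
  move=> e e0; exists (Num.min (x - a') (b' - x)); split; first by rewrite lt_min; apply/andP; lra.
  move=> y; rewrite lt_min => /andP[]; rewrite !ltr_norml => /andP[? ?] /andP[? ?].
  suff -> : f y = f x by rewrite subrr; apply/andP; lra.
  have [xy|yx|-> //] := ltgtP x y; first by rewrite (hm x y) //; lra.
  by rewrite (hm y x) //; lra.
have [|a' [b' [ab' hin hm]]] := key (fun u v => - u < - v) _ _ dgt ac.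
  move=> x ax xb; have [|[|//]] := P123 x.
    by move=> /h1 h; exfalso; apply: h; lra.
  by move=> /h2 h; exfalso; apply: h; lra.
have [] := inside a' b' ab'; first by move=> x /hin h /h; lra.
move=> aa' bb'.
have dg : Dmap S (fun x => - f x) by def_auto.
have [a'' [b'' [h3 h4 h5]]] := incr _ a' b' dg aa' ab' bb' hm.
exists a'', b''; split=> //; last by right.
by move=> x ax xb; have [? ? /cont1N ?] := h4 x ax xb.
Qed.

End OneVariable.

(** * Generic continuity in several variables *)

Section Boxes.
Set Implicit Arguments.
Unset Strict Implicit.
Unset Printing Implicit Defensive.
Local Open Scope classical_set_scope.
Local Open Scope ring_scope.

Variables (R : rcfType) (S : ominimal_structure R).
Implicit Types E F : dtype R.

Definition near m (x y : 'rV[R]_m) (d : R) : Prop := forall i, `|x ord0 i - y ord0 i| < d.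

Definition snoc m (x : 'rV[R]_m) (t : R) : 'rV[R]_m.+1 :=
  \row_i (if unlift ord_max i is Some j then x ord0 j else t).

Lemma init_snoc m (x : 'rV[R]_m) t : init (snoc x t) = x.
Proof. by apply/rowP => i; rewrite initE mxE liftK. Qed.

Lemma last_snoc m (x : 'rV[R]_m) t : snoc x t ord0 ord_max = t.
Proof. by rewrite mxE unlift_none. Qed.

Lemma snocK m (z : 'rV[R]_m.+1) : snoc (init z) (z ord0 ord_max) = z.
Proof.
by apply/rowP => i; rewrite mxE; case: unliftP => [j ->|->//]; rewrite initE.
Qed.

Lemma snocP m (P : 'rV[R]_m.+1 -> Prop) : (forall x t, P (snoc x t)) -> forall z, P z.
Proof. by move=> h z; rewrite -(snocK z). Qed.

Lemma near_snoc m (x y : 'rV[R]_m) t s d :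
  near (snoc x t) (snoc y s) d <-> near x y d /\ `|t - s| < d.
Proof.
split=> [h|[h1 h2] i].
  split=> [i|]; last by have := h ord_max; rewrite !last_snoc.
  by have := h (lift ord_max i); rewrite -!initE !init_snoc.
by rewrite !mxE; case: unliftP => [j _|_//]; apply: h1.
Qed.

Lemma near_refl m (x : 'rV[R]_m) d : 0 < d -> near x x d.
Proof. by move=> d0 i; rewrite subrr normr0. Qed.

Lemma near_le m (x y : 'rV[R]_m) d d' : d <= d' -> near x y d -> near x y d'.
Proof. by move=> dd h i; apply: lt_le_trans (h i) dd. Qed.

Lemma near_trans m (x y z : 'rV[R]_m) d d' :
  near x y d -> near y z d' -> near x z (d + d').
Proof.
move=> h h' i; apply: le_lt_trans (ltrD (h i) (h' i)).
by apply: le_trans (ler_normD _ _); rewrite addrA subrK.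
Qed.

Lemma abs_recenter (t c c' e e' : R) :
  `|t - c'| < e' -> `|c - c'| + e' <= e -> `|t - c| < e.
Proof.
move=> te ce; apply: lt_le_trans ce.
by apply: le_lt_trans (ler_distD c' _ _) _; rewrite (distrC c' c) addrC ltrD2l.
Qed.

Lemma min_pos2 (a b : R) : 0 < a -> 0 < b -> exists c : R, [/\ 0 < c, c <= a & c <= b].
Proof.
by move=> a0 b0; exists (Num.min a b); rewrite lt_min a0 b0 !ge_min !lexx orbT.
Qed.

Lemma Def_near E m (f g : E -> 'rV[R]_m) (d : E -> R) :
  Dmap S f -> Dmap S g -> Dmap S d -> Def S (fun z => near (f z) (g z) (d z)).
Proof. by move=> df dg dd; rewrite /near; def_auto. Qed.

Lemma Dmap_snoc E m (f : E -> 'rV[R]_m) (g : E -> R) :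
  Dmap S f -> Dmap S g -> Dmap S (fun z => snoc (f z) (g z)).
Proof.
move=> df dg; apply: Dmap_row => j; case: (unliftP ord_max j) => [i|] ->.
  apply: (Dmap_ext (f := fun z => f z ord0 i)); last by def_auto.
  by move=> z; rewrite mxE liftK.
by apply: (Dmap_ext (f := g)) => // z; rewrite mxE unlift_none.
Qed.

Lemma Dmap_init E m (f : E -> 'rV[R]_m.+1) : Dmap S f -> Dmap S (fun z => init (f z)).
Proof.
move=> df; apply: Dmap_row => j.
apply: (Dmap_ext (f := fun z => f z ord0 (lift ord_max j))); last by def_auto.
by move=> z; rewrite initE.
Qed.

End Boxes.

Ltac def_more ::=
  lazymatch goal with
  | |- Def _ (fun z => near (@?f z) (@?g z) (@?d z)) =>
      refine (@Def_near _ _ _ _ f g d _ _ _)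
  | |- Dmap _ (fun z => snoc (@?f z) (@?g z)) => refine (@Dmap_snoc _ _ _ _ f g _ _)
  | |- Dmap _ (fun z => init (@?f z)) => refine (@Dmap_init _ _ _ _ f _)
  end.

Section GenericContinuity.
Set Implicit Arguments.
Unset Strict Implicit.
Unset Printing Implicit Defensive.
Local Open Scope classical_set_scope.
Local Open Scope ring_scope.

Variables (R : rcfType) (S : ominimal_structure R).
Implicit Types E F : dtype R.

Definition contat m (f : 'rV[R]_m -> R) (x : 'rV[R]_m) :=
  forall e : R, 0 < e -> exists d : R, 0 < d /\ forall y, near x y d -> `|f y - f x| < e.

(** The interior is dense. *)
Definition big m (A : 'rV[R]_m -> Prop) := forall p (d : R), 0 < d ->
  exists p' (d' : R), 0 < d' /\ forall x, near p' x d' -> near p x d /\ A x.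

Definition generically_continuous m :=
  forall f : 'rV[R]_m -> R, Dmap S f -> big (contat f).

Definition box_dichotomy m := forall A : 'rV[R]_m -> Prop, Def S A ->
  forall p (d : R), 0 < d -> exists p' (d' : R), [/\ 0 < d',
    forall x, near p' x d' -> near p x d &
    (forall x, near p' x d' -> A x) \/ (forall x, near p' x d' -> ~ A x)].

(** Choose the centre and the radius as definable functions of [x]; near a common
    continuity point one interval works for all [x]. *)
Lemma uniform_interval m (Q : 'rV[R]_m * R * R -> Prop) p (d : R) :
  generically_continuous m -> Def S Q -> 0 < d ->
  (forall x, near p x d -> exists c e : R, 0 < e /\ Q (x, c, e)) ->
  (forall x (c c' e e' : R), Q (x, c, e) -> 0 < e' -> `|c - c'| + e' <= e -> Q (x, c', e')) ->
  exists p' (d' c0 e0 : R), [/\ 0 < d', 0 < e0 &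
    forall x, near p' x d' -> near p x d /\ Q (x, c0, e0)].
Proof.
move=> gc dQ d0 ex her.
have dA : Def S (fun z : 'rV[R]_m * R => exists e : R, 0 < e /\ Q (z, e)) by def_auto.
have [f [df hf]] := definable_choice dA.
have dB : Def S (fun z : 'rV[R]_m * R => 0 < z.2 /\ Q (z.1, f z.1, z.2)) by def_auto.
have [g [dg hg]] := definable_choice dB.
have {hf}hg x : near p x d -> 0 < g x /\ Q (x, f x, g x).
  by move=> /ex[c [e h]]; apply: (hg x); apply: hf; exists c, e.
have [p1 [d1 [d10 h1]]] := gc f df p d d0.
have [q [d2 [d20 h2]]] := gc g dg p1 d1 d10.
have [qp1 cg] := h2 q (near_refl q d20).
have [qp cf] := h1 q qp1.
have [gq0 _] := hg q qp.
have e40 : 0 < g q / 4 by lra.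
have [a [a0 ha]] := cf _ e40.
have [b [b0 hb]] := cg _ e40.
have [c [c0 ca cb]] := min_pos2 a0 b0.
have [r [r0 rc rd]] := min_pos2 c0 d20.
exists q, r, (f q), (g q / 4); split=> // x xr.
have xp : near p x d by have [] := h2 x (near_le rd xr) => /h1[].
split=> //; have [_ Qx] := hg x xp; apply: her Qx e40 _.
have h3 : `|f x - f q| < g q / 4 by apply: ha; apply: near_le xr; lra.
have h4 : `|g x - g q| < g q / 4 by apply: hb; apply: near_le xr; lra.
by move: h4; rewrite ltr_norml => /andP[? ?]; lra.
Qed.

(** On a smaller box of the base, either all fibres of [A] contain an interval or all fibres
    of its complement do, and such intervals can be chosen uniformly. *)
Lemma box_dichotomy_step m :
  generically_continuous m -> box_dichotomy m -> box_dichotomy m.+1.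
Proof.
move=> gc dich A dA p d d0; pose t0 := p ord0 ord_max.
pose Q (B : 'rV[R]_m.+1 -> Prop) (z : 'rV[R]_m * R * R) :=
  forall t : R, `|t - z.1.2| < z.2 -> `|t - t0| < d /\ B (snoc z.1.1 t).
have herQ B x (c c' e e' : R) :
    Q B (x, c, e) -> 0 < e' -> `|c - c'| + e' <= e -> Q B (x, c', e').
  by move=> h _ ce t /= te; apply: h; apply: abs_recenter te ce.
have dQ B : Def S B -> Def S (Q B) by move=> dB; rewrite /Q; def_auto.
have box B p1 (d1 : R) : Def S B -> 0 < d1 -> (forall x, near p1 x d1 -> near (init p) x d) ->
    (forall x, near p1 x d1 -> exists c e : R, 0 < e /\ Q B (x, c, e)) ->
    exists p' (d' : R), [/\ 0 < d', forall x, near p' x d' -> near p x d &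
      forall x, near p' x d' -> B x].
  move=> dB d10 sub ex.
  have [p2 [d2 [c [e [d20 e0 h]]]]] :=
    uniform_interval gc (dQ _ dB) d10 ex (herQ B).
  have [r [r0 rd re]] := min_pos2 d20 e0.
  suff h' z : near (snoc p2 c) z r -> near p z d /\ B z.
    by exists (snoc p2 c), r; split=> // x /h' [].
  elim/snocP: z => x t /near_snoc[xr tr].
  have [/sub xp Qx] := h x (near_le rd xr).
  have [|tt Bx] := Qx t; first by rewrite /= distrC; apply: lt_le_trans re.
  by split=> //; rewrite -(snocK p) near_snoc distrC.
pose A1 x := exists c e : R, 0 < e /\ Q A (x, c, e).
have dA1 : Def S A1 by have dQA := dQ _ dA; rewrite /A1; def_auto.
have [p1 [d1 [d10 sub [h|h]]]] := dich A1 dA1 (init p) d d0.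
  have [p' [d' [d'0 s b]]] := box A p1 d1 dA d10 sub h.
  by exists p', d'; split=> //; left.
have dnA : Def S (fun x => ~ A x) by def_auto.
have [|p' [d' [d'0 s b]]] := box _ p1 d1 dnA d10 sub; last first.
  by exists p', d'; split=> //; right.
move=> x /h nA1.
have dAx : Def S (fun t : R => A (snoc x t)) by def_auto.
have [b [tb hb]] := germ_right t0 dAx.
have bt : 0 < b - t0 by lra.
have [e [e0 eb ed]] := min_pos2 bt d0.
have [{}hb|{}hb] := hb.
  exfalso; apply: nA1; exists (t0 + e / 2), (e / 2); split; first by lra.
  move=> t /=; rewrite ltr_norml => /andP[? ?]; split; last by apply: hb; lra.
  by rewrite ltr_norml; apply/andP; lra.
exists (t0 + e / 2), (e / 2); split; first by lra.
move=> t /=; rewrite ltr_norml => /andP[? ?]; split; last by apply: hb; lra.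
by rewrite ltr_norml; apply/andP; lra.
Qed.

(** By the dichotomy there is a box on which [f] is also continuous in the first variables
    for each value of the last one: otherwise generic continuity of a slice would fail.
    Between two slices with values close to [f (snoc x t)] at [x], monotonicity in the last
    variable then controls [f] near [snoc x t]. *)
Lemma monotone_slices_continuous m (f : 'rV[R]_m.+1 -> R) p1 (d1 c0 eps0 : R) :
  generically_continuous m -> box_dichotomy m.+1 -> Dmap S f -> 0 < d1 -> 0 < eps0 ->
  (forall x, near p1 x d1 -> forall t s : R, `|t - c0| < eps0 -> `|s - c0| < eps0 ->
     (t <= s -> f (snoc x t) <= f (snoc x s)) /\ cont1 (fun t => f (snoc x t)) t) ->
  exists p' (d' : R), 0 < d' /\ forall z, near p' z d' ->
    [/\ near p1 (init z) d1, `|z ord0 ord_max - c0| < eps0 & contat f z].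
Proof.
move=> gc dich df d10 eps00 hf.
pose Ec (z : 'rV[R]_m.+1) := contat (fun x => f (snoc x (z ord0 ord_max))) (init z).
have dEc : Def S Ec by rewrite /Ec /contat; def_auto.
have [r [r0 rd re]] := min_pos2 d10 eps00.
have [p2 [d2 [d20 sub [h|h]]]] := dich Ec dEc (snoc p1 c0) r r0; last first.
  exfalso; have dg : Dmap S (fun x => f (snoc x (p2 ord0 ord_max))) by def_auto.
  have [p3 [d3 [d30 h3]]] := gc _ dg (init p2) d2 d20.
  have [n3 c3] := h3 p3 (near_refl _ d30).
  apply: (h (snoc p3 (p2 ord0 ord_max))).
    by rewrite -{1}(snocK p2) near_snoc subrr normr0.
  by rewrite /Ec init_snoc last_snoc.
have sub' x t : near (init p2) x d2 -> `|p2 ord0 ord_max - t| < d2 ->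
    [/\ near p1 x d1, `|t - c0| < eps0 & contat (fun x => f (snoc x t)) x].
  move=> xp tp; have xt : near p2 (snoc x t) d2 by rewrite -(snocK p2) near_snoc.
  have /near_snoc[h1 h2] := sub _ xt; have := h _ xt.
  rewrite /Ec init_snoc last_snoc => h3.
  by split=> //; [apply: near_le h1|rewrite distrC; apply: lt_le_trans re].
exists p2, (d2 / 2); split; first by lra.
have d22 : d2 / 2 <= d2 by lra.
elim/snocP=> x t; rewrite -{1}(snocK p2) near_snoc init_snoc last_snoc => -[xp tp].
have [xp1 tc _] := sub' x t (near_le d22 xp) (lt_le_trans tp d22).
split=> // e e0.
have e20 : 0 < e / 2 by lra.
have [_ ct] := hf x xp1 t t tc tc.
have [a [a0 ha]] := ct _ e20.
have d40 : 0 < d2 / 4 by lra.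
have [b [b0 ba bd]] := min_pos2 a0 d40.
have {}tp : - (d2 / 2) < p2 ord0 ord_max - t < d2 / 2 by move: tp; rewrite ltr_norml.
move/andP: tp => [tp1 tp2].
have t1p : `|p2 ord0 ord_max - (t - b / 2)| < d2 by rewrite ltr_norml; apply/andP; lra.
have t2p : `|p2 ord0 ord_max - (t + b / 2)| < d2 by rewrite ltr_norml; apply/andP; lra.
have [_ t1c c1] := sub' x _ (near_le d22 xp) t1p.
have [_ t2c c2] := sub' x _ (near_le d22 xp) t2p.
have f1 : `|f (snoc x (t - b / 2)) - f (snoc x t)| < e / 2.
  by apply: ha; rewrite ltr_norml; apply/andP; lra.
have f2 : `|f (snoc x (t + b / 2)) - f (snoc x t)| < e / 2.
  by apply: ha; rewrite ltr_norml; apply/andP; lra.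
have [a1 [a10 ha1]] := c1 _ e20.
have [a2 [a20 ha2]] := c2 _ e20.
have [u [u0 u1 u2]] := min_pos2 a10 a20.
have b20 : 0 < b / 2 by lra.
have [v [v0 vu vb]] := min_pos2 u0 b20.
have d220 : 0 < d2 / 2 by clear -d20; lra.
have [w [w0 wv wd]] := min_pos2 v0 d220.
exists w; split=> //; elim/snocP=> y s /near_snoc[xy ts].
have yp : near (init p2) y d2.
  by apply: near_le (near_trans xp xy); clear -wd; lra.
have {}ts : - w < t - s < w by move: ts; rewrite ltr_norml.
move/andP: ts => [ts1 ts2].
have sp : `|p2 ord0 ord_max - s| < d2.
  by rewrite ltr_norml; apply/andP; clear -tp1 tp2 ts1 ts2 wv vb bd d20; lra.
have [yp1 sc _] := sub' y s yp sp.
have [m1 _] := hf y yp1 (t - b / 2) s t1c sc.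
have [m2 _] := hf y yp1 s (t + b / 2) sc t2c.
have {}m1 := m1 ltac:(clear -ts2 wv vb; lra).
have {}m2 := m2 ltac:(clear -ts1 wv vb; lra).
have g1 := ha1 y (near_le (le_trans wv (le_trans vu u1)) xy).
have g2 := ha2 y (near_le (le_trans wv (le_trans vu u2)) xy).
clear -f1 f2 g1 g2 m1 m2; move: f1 f2 g1 g2.
rewrite !ltr_norml => /andP[? ?] /andP[? ?] /andP[? ?] /andP[? ?].
by apply/andP; lra.
Qed.

Lemma contatN m (f : 'rV[R]_m -> R) x : contat (fun y => - f y) x -> contat f x.
Proof.
move=> h e /h[d [d0 hd]]; exists d; split=> // y /hd.
by rewrite -opprD normrN.
Qed.

(** Monotonicity intervals of the functions [f (snoc x _)] can be chosen uniformly in [x]. *)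
Lemma generically_continuous_step m :
  generically_continuous m -> box_dichotomy m -> generically_continuous m.+1.
Proof.
move=> gc dich f df p d d0; pose t0 := p ord0 ord_max.
have dich' := box_dichotomy_step gc dich.
pose Q (g : 'rV[R]_m.+1 -> R) (z : 'rV[R]_m * R * R) := forall t s : R,
  `|t - z.1.2| < z.2 -> `|s - z.1.2| < z.2 -> `|t - t0| < d /\
  ((t <= s -> g (snoc z.1.1 t) <= g (snoc z.1.1 s)) /\ cont1 (fun t => g (snoc z.1.1 t)) t).
have herQ g x (c c' e e' : R) :
    Q g (x, c, e) -> 0 < e' -> `|c - c'| + e' <= e -> Q g (x, c', e').
  move=> h _ ce t s /= te se.
  by apply: h; [apply: abs_recenter te ce|apply: abs_recenter se ce].
have dQ g : Dmap S g -> Def S (Q g) by move=> dg; rewrite /Q /cont1; def_auto.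
have box g p1 (d1 : R) : Dmap S g -> 0 < d1 -> (forall x, near p1 x d1 -> near (init p) x d) ->
    (forall x, near p1 x d1 -> exists c e : R, 0 < e /\ Q g (x, c, e)) ->
    exists p' (d' : R), 0 < d' /\ forall x, near p' x d' -> near p x d /\ contat g x.
  move=> dg d10 sub ex.
  have [p2 [d2 [c [e [d20 e0 h]]]]] :=
    uniform_interval gc (dQ _ dg) d10 ex (herQ g).
  have [|p3 [d3 [d30 h3]]] :=
    monotone_slices_continuous (p1 := p2) (c0 := c) gc dich' dg d20 e0.
    by move=> x /h[_ Qx] t s tc sc; have [_] := Qx t s tc sc.
  exists p3, d3; split=> // z /h3[h4 h5 h6]; split=> //.
  have [/sub h7 Qz] := h _ h4; have [h8 _] := Qz _ _ h5 h5.
  by rewrite -(snocK p) -(snocK z) near_snoc distrC.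
pose P1 x := exists c e : R, 0 < e /\ Q f (x, c, e).
have dP1 : Def S P1 by have dQf := dQ _ df; rewrite /P1; def_auto.
have [p1 [d1 [d10 sub [h|h]]]] := dich P1 dP1 (init p) d d0; first exact: box h.
have dg : Dmap S (fun z => - f z) by def_auto.
have [|p2 [d2 [d20 h2]]] := box _ p1 d1 dg d10 sub; last first.
  by exists p2, d2; split=> // z /h2[? /contatN].
move=> x /h nP1.
have dfx : Dmap S (fun t : R => f (snoc x t)) by def_auto.
have tt : t0 < t0 + d by lra.
have [a [b [ab hab mono]]] := locally_monotone dfx tt.
have inI (t : R) : `|t - (a + b) / 2| < (b - a) / 2 -> a < t /\ t < b.
  by rewrite ltr_norml => /andP; lra.
have inD (t : R) : a < t -> t < b -> `|t - t0| < d.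
  by move=> at_ tb; have [? ? _] := hab t at_ tb; rewrite ltr_norml; apply/andP; lra.
have ba : 0 < (b - a) / 2 by lra.
case: mono => mono.
  exfalso; apply: nP1; exists ((a + b) / 2), ((b - a) / 2); split=> //.
  move=> t s /inI[at_ tb] /inI[as_ sb]; split; first exact: inD.
  by split=> [ts|]; [apply: mono|have [] := hab t at_ tb].
exists ((a + b) / 2), ((b - a) / 2); split=> //.
move=> t s /inI[at_ tb] /inI[as_ sb]; split; first exact: inD.
split=> [ts|]; first exact: mono.
have [_ _ c] := hab t at_ tb; move=> e /c[r [r0 hr]]; exists r; split=> // y /hr.
by rewrite /= -opprD normrN.
Qed.

Lemma row0_eq (x y : 'rV[R]_0) : x = y.
Proof. by apply/rowP => -[]. Qed.

Lemma generic_continuity_and_dichotomy m : generically_continuous m /\ box_dichotomy m.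
Proof.
elim: m => [|m [gc dich]]; last first.
  by split; [apply: generically_continuous_step|apply: box_dichotomy_step].
split=> [f df p d d0|A dA p d d0].
  exists p, d; split=> // x _; split; first by case.
  by move=> e e0; exists 1; split=> // y _; rewrite (row0_eq y x) subrr normr0.
exists p, d; split=> //.
by have [h|h] := pselect (A p); [left|right] => x _; rewrite (row0_eq x p).
Qed.

Lemma generic_continuity m : generically_continuous m.
Proof. by have [] := generic_continuity_and_dichotomy m. Qed.

End GenericContinuity.

(** * Uniform finiteness *)

Section FiniteFibers.
Set Implicit Arguments.
Unset Strict Implicit.
Unset Printing Implicit Defensive.
Local Open Scope classical_set_scope.
Local Open Scope ring_scope.

Variables (R : rcfType) (S : ominimal_structure R).
Implicit Types E F : dtype R.

Definition card_le (P : R -> Prop) (N : nat) :=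
  exists s : seq R, (size s <= N)%N /\ forall x, P x -> x \in s.

Lemma card_le_sub (P Q : R -> Prop) N : (forall x, P x -> Q x) -> card_le Q N -> card_le P N.
Proof. by move=> PQ [s [sN h]]; exists s; split=> // x /PQ/h. Qed.

Lemma card_le_image (P Q : R -> Prop) (r : R -> R -> Prop) N :
  (forall x, P x -> exists y, Q y /\ r x y) ->
  (forall x x' y, r x y -> r x' y -> x = x') -> card_le Q N -> card_le P N.
Proof.
move=> PQ inj [s [sN hs]].
have /choice[h hh] : forall y, exists x, (exists x, r x y) -> r x y.
  move=> y; have [[x hx]|n] := pselect (exists x, r x y); first by exists x.
  by exists 0.
exists (map h s); split; first by rewrite size_map.
move=> x /PQ[y [Qy rxy]].
have ry : r (h y) y by apply: hh; exists x.
by rewrite (inj _ _ _ rxy ry); apply: map_f; apply: hs.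
Qed.

Lemma card_le_cons (P : R -> Prop) a N : P a ->
  card_le P N.+1 <-> card_le (fun x => P x /\ x <> a) N.
Proof.
move=> Pa; split=> -[s [sN hs]].
  have as_ : a \in undup s by rewrite mem_undup hs.
  exists (rem a (undup s)); split.
    by rewrite size_rem // -ltnS; apply: leq_trans sN; rewrite prednK ?size_undup //; case: (undup s) as_.
  move=> x [Px /eqP xa]; rewrite mem_rem_uniq ?undup_uniq // inE mem_undup hs // andbT.
  exact: xa.
exists (a :: s); split; first by [].
by move=> x Px; rewrite inE; case: eqVneq => //= /eqP xa; apply: hs.
Qed.

Lemma Def_card_le E (P : E * R -> Prop) N : Def S P ->
  Def S (fun x => card_le (fun t => P (x, t)) N).
Proof.
move=> dP; have : Def S (fun x => exists v : 'I_N -> R, forall t, P (x, t) -> exists i, t = component v i).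
  by def_auto.
apply: Def_ext => x; split=> [[v hv]|[s [sN hs]]].
  exists [seq v i | i <- enum 'I_N]; split; first by rewrite size_map size_enum_ord.
  by move=> t /hv[i ->]; apply: map_f; rewrite mem_enum.
exists (fun i => nth 0 s i) => t /hs ts.
have ti : (index t s < N)%N by apply: leq_trans sN; rewrite index_mem.
by exists (Ordinal ti); rewrite /component /= nth_index.
Qed.

Lemma fin_next (P : R -> Prop) (a : R) : fin P -> (exists x, P x /\ a < x) ->
  exists x0, [/\ P x0, a < x0 & forall y, P y -> a < y -> x0 <= y].
Proof.
move=> [s hs] [x [Px ax]].
have mem y : y \in [seq z <- s | `[<P z>]] <-> P y.
  rewrite mem_filter; split=> [/andP[/asboolP //]|Py].
  by rewrite hs // andbT; apply/asboolP.
have [h|[z [/mem Pz az hz]]] := next_in_seq [seq z <- s | `[<P z>]] a.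
  by have := h x ((mem x).2 Px); lra.
by exists z; split=> // y /mem /hz.
Qed.

Lemma fin_prev (P : R -> Prop) (a : R) : fin P -> (exists x, P x /\ x < a) ->
  exists x0, [/\ P x0, x0 < a & forall y, P y -> y < a -> y <= x0].
Proof.
move=> [s hs] [x [Px ax]].
have [||z [Pz az hz]] := @fin_next (fun y => P (- y)) (- a).
- exists (map -%R s) => y /hs h; rewrite -(opprK y); exact: map_f.
- by exists (- x); rewrite opprK ltrN2.
exists (- z); split=> //; first by lra.
move=> y Py ya; have := hz (- y); rewrite opprK => /(_ Py ltac:(lra)); lra.
Qed.

Lemma fin_bigunion (P : R -> Prop) (Q : R -> R -> Prop) : fin P -> (forall t, fin (Q t)) ->
  fin (fun u => exists t, P t /\ Q t u).
Proof.
move=> [s hs] /choice[q hq]; exists (flatten (map q s)) => u [t [/hs ts /hq uq]].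
by apply/flattenP; exists (q t) => //; apply: map_f.
Qed.

(** Intervals are connected with respect to definable sets. *)
Lemma locally_constant (X : R -> Prop) (a b : R) : Def S X ->
  (forall t, a < t -> t < b -> exists d : R, 0 < d /\ forall s, `|s - t| < d -> (X s <-> X t)) ->
  forall t t', a < t -> t < b -> a < t' -> t' < b -> X t -> X t'.
Proof.
have half (Y : R -> Prop) : Def S Y ->
    (forall t, a < t -> t < b -> exists d : R, 0 < d /\ forall s, `|s - t| < d -> (Y s <-> Y t)) ->
    forall t t', a < t -> t < t' -> t' < b -> Y t -> Y t'.
  move=> dY loc t t' at_ tt tb Yt; apply: contrapT => nY.
  have dK : Def S (fun s => t < s /\ ~ Y s) by def_auto.
  have [||m [m1 m2]] := glb_exists (l := t) dK; first by exists t'.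
    by move=> x [/ltW].
  have tm : t <= m by apply: m2 => x [/ltW].
  have mt : m <= t' by apply: m1.
  have [||d [d0 hd]] := loc m; [lra|lra|].
  have [Ym|nYm] := pselect (Y m).
    suff : m + d <= m by lra.
    apply: m2 => x [tx nYx]; rewrite leNgt; apply/negP => xm.
    have mx : m <= x by apply: m1.
    apply: nYx; apply/hd => //.
    by rewrite ltr_norml; apply/andP; lra.
  have tm' : t < m by rewrite lt_neqAle tm andbT; apply/eqP => e; apply: nYm; rewrite -e.
  have [e [e0 ed em]] := min_pos2 d0 (ltac:(lra) : 0 < m - t).
  suff : m <= m - e / 2 by lra.
  apply: m1; split; first by lra.
  by move=> Ye; apply: nYm; apply/(hd (m - e / 2)) => //; rewrite ltr_norml; apply/andP; lra.
move=> dX loc t t' at_ tb at' tb' Xt; have [tt|tt|<- //] := ltgtP t t'.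
  exact: half Xt.
apply: contrapT => nX; apply: (half (fun x => ~ X x) _ _ t' t) => //; first by def_auto.
move=> s as_ sb; have [d [d0 hd]] := loc s as_ sb; exists d; split=> // x /hd h.
by split=> n /h.
Qed.

End FiniteFibers.

Section Covering.
Set Implicit Arguments.
Unset Strict Implicit.
Unset Printing Implicit Defensive.
Local Open Scope classical_set_scope.
Local Open Scope ring_scope.

Variables (R : rcfType) (S : ominimal_structure R).
Implicit Types E F : dtype R.
Implicit Type A : R -> R -> Prop.

(** The three ways in which a family of finite sets may fail to move continuously
    at [t]: a point disappears, points collide, or a point appears in a gap. *)
Definition point_lost A (t : R) := exists r : R, A t r /\ exists e : R, 0 < e /\
  forall d : R, 0 < d -> exists s : R, `|s - t| < d /\ forall r' : R, A s r' -> ~ `|r' - r| < e.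

Definition points_collide A (t : R) := exists r : R, A t r /\
  forall e d : R, 0 < e -> 0 < d -> exists s r' r'' : R,
    `|s - t| < d /\ (A s r' /\ A s r'') /\ (r' <> r'' /\ (`|r' - r| < e /\ `|r'' - r| < e)).

Definition point_born A (t : R) := exists c d : R, c <= d /\
  (forall r : R, A t r -> ~ (c <= r /\ r <= d)) /\
  forall e : R, 0 < e -> exists s : R, `|s - t| < e /\ exists r : R, A s r /\ (c <= r /\ r <= d).

Definition bad A t := point_lost A t \/ points_collide A t \/ point_born A t.

(** Closing the fibres up at both ends makes every gap lie between two points of
    the fibre. *)
Definition closed_up A := forall t, A t 1 /\ A t (-1) /\ forall r, A t r -> -1 <= r /\ r <= 1.

Lemma two_continuous (f g : R -> R) (a b : R) : Dmap S f -> Dmap S g -> a < b ->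
  exists t (d : R), [/\ 0 < d, forall s, `|s - t| < d -> a < s /\ s < b, cont1 f t & cont1 g t].
Proof.
move=> df dg ab.
have [a1 [b1 [ab1 h1 _]]] := locally_monotone df ab.
have [a2 [b2 [ab2 h2 _]]] := locally_monotone dg ab1.
have m1 : a2 < (a2 + b2) / 2 by lra.
have m2 : (a2 + b2) / 2 < b2 by lra.
have [h3 h4 cg] := h2 _ m1 m2; have [_ _ cf] := h1 _ h3 h4.
exists ((a2 + b2) / 2), ((b2 - a2) / 2); split=> //; first by lra.
move=> s; rewrite ltr_norml => /andP[? ?].
have [||h5 h6 _] := h2 s; [lra|lra|].
by have [] := h1 s h5 h6.
Qed.

(** A definable choice of the lost point is continuous somewhere, and its values nearby
    are points of the fibres close to it. *)
Lemma point_lost_not_interval A (a b : R) : Def S (fun z : R * R => A z.1 z.2) -> a < b ->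
  ~ (forall t, a < t -> t < b -> point_lost A t).
Proof.
move=> dA ab h; pose B z := A z.1 z.2.
pose Q (z : R * R) := B z /\ exists e : R, 0 < e /\ forall d : R, 0 < d ->
  exists s : R, `|s - z.1| < d /\ forall r' : R, B (s, r') -> ~ `|r' - z.2| < e.
have dQ : Def S Q by change (Def S B) in dA; rewrite /Q; clearbody B; def_auto.
have [f [df hf]] := definable_choice dQ.
have [t [d [d0 hd cf _]]] := two_continuous df df ab.
have {}hf s : `|s - t| < d -> Q (s, f s) by move=> /hd[/h{}h /h{}h]; apply: hf.
have [_ [e [e0 he]]] := hf t ltac:(by rewrite subrr normr0).
have [d1 [d10 hd1]] := cf e e0.
have [c [c0 cd cd1]] := min_pos2 d0 d10.
have [s [/= st hs]] := he c c0.
have [As _] := hf s (lt_le_trans st cd).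
by apply: hs As _; apply: hd1; apply: lt_le_trans cd1.
Qed.

Lemma quarter_close (fs ft gs gt x : R) : `|fs - ft| < gt / 4 -> `|gs - gt| < gt / 4 ->
  `|x - ft| < gt / 4 -> `|x - fs| < gs.
Proof. by rewrite !ltr_norml => /andP[? ?] /andP[? ?] /andP[? ?]; apply/andP; lra. Qed.

(** Choose definably the collision point [f t] and a radius [g t] within which it is isolated in
    its fibre; at a common continuity point the isolation persists. *)
Lemma points_collide_not_interval A (a b : R) : Def S (fun z : R * R => A z.1 z.2) ->
  (forall t, fin (A t)) -> a < b -> ~ (forall t, a < t -> t < b -> points_collide A t).
Proof.
move=> dA finA ab h; pose B z := A z.1 z.2.
pose Q (z : R * R) := B z /\ forall e d : R, 0 < e -> 0 < d -> exists s r' r'' : R,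
    `|s - z.1| < d /\ (B (s, r') /\ B (s, r'')) /\ (r' <> r'' /\ (`|r' - z.2| < e /\ `|r'' - z.2| < e)).
have dQ : Def S Q by change (Def S B) in dA; rewrite /Q; clearbody B; def_auto.
have [f [df hf]] := definable_choice dQ.
pose P (z : R * R) := 0 < z.2 /\ forall r : R, B (z.1, r) -> `|r - f z.1| < z.2 -> r = f z.1.
have dP : Def S P by change (Def S B) in dA; rewrite /P; clearbody B; def_auto.
have [g [dg hg]] := definable_choice dP.
have [t [d [d0 hd cf cg]]] := two_continuous df dg ab.
have {}hg s : P (s, g s).
  apply: hg; have [L hL] := finA s.
  have [e [e0 he]] := pos_below_seq (map (fun r => `|r - f s|) L).
  exists e; split=> //= r Br re; apply: contrapT => rf.
  have rf0 : 0 < `|r - f s| by rewrite normr_gt0 subr_eq0; exact/eqP.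
  by have := he _ (map_f (fun x => `|x - f s|) (hL r Br)) rf0; lra.
have {}hf s : `|s - t| < d -> Q (s, f s) by move=> /hd[/h{}h /h{}h]; apply: hf.
have [_ he] := hf t ltac:(by rewrite subrr normr0).
have [gt0 _] := hg t; rewrite /= in gt0.
have g40 : 0 < g t / 4 by lra.
have [d1 [d10 hd1]] := cf _ g40.
have [d2 [d20 hd2]] := cg _ g40.
have [c1 [c10 c1d1 c1d2]] := min_pos2 d10 d20.
have [s [r' [r'' [/= st [[A1 A2] [n [n1 n2]]]]]]] := he _ _ g40 c10.
have f1 := hd1 s (lt_le_trans st c1d1); have g1 := hd2 s (lt_le_trans st c1d2).
have [_ /= uniq_] := hg s.
by apply: n; rewrite (uniq_ r' A1 (quarter_close f1 g1 n1)) (uniq_ r'' A2 (quarter_close f1 g1 n2)).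
Qed.

(** Choose definably the ends of the gap; at a common continuity point the gap persists. *)
Lemma point_born_not_interval A (a b : R) : Def S (fun z : R * R => A z.1 z.2) ->
  closed_up A -> (forall t, fin (A t)) -> a < b ->
  ~ (forall t, a < t -> t < b -> point_born A t).
Proof.
move=> dA cA finA ab h; pose B z := A z.1 z.2.
pose Q (z : R * R * R) := (z.1.2 < z.2 /\ (forall r : R, B (z.1.1, r) -> ~ (z.1.2 < r /\ r < z.2))) /\
  exists c d : R, (z.1.2 < c /\ d < z.2) /\
    forall e : R, 0 < e -> exists s : R, `|s - z.1.1| < e /\ exists r : R, B (s, r) /\ (c <= r /\ r <= d).
have dQ : Def S Q by change (Def S B) in dA; rewrite /Q; clearbody B; def_auto.
have exQ t : a < t -> t < b -> exists r1 r2, Q (t, r1, r2).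
  move=> at_ tb; have [c [d [cd [gap he]]]] := h t at_ tb.
  have [s [_ [r [Ar [cr rd]]]]] := he 1 ltr01.
  have [_ [_ /(_ r Ar)[r1 r2]]] := cA s.
  have [A1 [A2 A3]] := cA t.
  have d1 : d < 1 by rewrite ltNge; apply/negP => d1; apply: (gap 1) => //; lra.
  have c1 : -1 < c by rewrite ltNge; apply/negP => c1; apply: (gap (-1)) => //; lra.
  have [|u [Au uc hu]] := @fin_prev _ (A t) c (finA t); first by exists (-1).
  have [|v [Av vd hv]] := @fin_next _ (A t) d (finA t); first by exists 1.
  exists u, v; split; last by exists c, d.
  split=> /=; first by lra.
  move=> x Bx [ux xv]; have := gap x Bx.
  have [xc|cx] := ltP x c; first by have := hu x Bx xc; lra.
  have [dx|xd] := ltP d x; first by have := hv x Bx dx; lra.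
  by apply.
have dQ1 : Def S (fun z : R * R => exists r2 : R, Q (z, r2)) by def_auto.
have [f [df hf]] := definable_choice dQ1.
have dQ2 : Def S (fun z : R * R => Q (z.1, f z.1, z.2)) by def_auto.
have [g [dg hg]] := definable_choice dQ2.
have {hf}hg s : a < s -> s < b -> Q (s, f s, g s).
  by move=> as_ sb; apply: (hg s); apply: (hf s); apply: exQ.
have [t [d [d0 hd cf cg]]] := two_continuous df dg ab.
have {}hg s : `|s - t| < d -> Q (s, f s, g s) by move=> /hd[? ?]; apply: hg.
have [_ [c [d' [/= [fc gd] he]]]] := hg t ltac:(by rewrite subrr normr0).
have [d1 [d10 hd1]] := cf _ (ltac:(lra) : 0 < c - f t).
have [d2 [d20 hd2]] := cg _ (ltac:(lra) : 0 < g t - d').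
have [e [e0 ed1 ed2]] := min_pos2 d10 d20.
have [e' [e'0 ee ed]] := min_pos2 e0 d0.
have [s [st [r [Br [cr rd]]]]] := he e' e'0.
have [[_ /(_ r Br)gap] _] := hg s (lt_le_trans st ed).
have f1 := hd1 s ltac:(lra); have g1 := hd2 s ltac:(lra).
by apply: gap; move: f1 g1; rewrite /= !ltr_norml => /andP[? ?] /andP[? ?]; lra.
Qed.

Lemma bad_fin A : Def S (fun z : R * R => A z.1 z.2) -> closed_up A ->
  (forall t, fin (A t)) -> fin (bad A).
Proof.
move=> dA cA finA; pose B z := A z.1 z.2.
have dB : Def S B by [].
have d1 : Def S (point_lost A).
  change (Def S (point_lost (fun x y => B (x, y)))); rewrite /point_lost; clearbody B; def_auto.
have d2 : Def S (points_collide A).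
  change (Def S (points_collide (fun x y => B (x, y)))); rewrite /points_collide; clearbody B; def_auto.
have d3 : Def S (point_born A).
  change (Def S (point_born (fun x y => B (x, y)))); rewrite /point_born; clearbody B; def_auto.
have d4 : Def S (bad A) by rewrite /bad; def_auto.
have [//|[a [b [ab h]]]] := fin_or_interval d4; exfalso.
have [b1 [ab1 [h1|h1]]] := germ_right a d1.
  exact: point_lost_not_interval dA ab1 h1.
have [b2 [ab2 [h2|h2]]] := germ_right a d2.
  exact: points_collide_not_interval dA finA ab2 h2.
have [c [c0 cb cb1]] := min_pos2 (ltac:(lra) : 0 < b - a) (ltac:(lra) : 0 < b1 - a).
have [c' [c'0 cc cb2]] := min_pos2 c0 (ltac:(lra) : 0 < b2 - a).
apply: (point_born_not_interval dA cA finA (ltac:(lra) : a < a + c')) => t at_ tb.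
have [||h3|[h3|//]] := h t; [lra|lra| |].
  by exfalso; apply: (h1 t at_) h3; lra.
by exfalso; apply: (h2 t at_) h3; lra.
Qed.

(** Induction along the points [rs] of the fibre above [c]: near [t0] the fibres have no point
    from [c] up to a little below the first of these, exactly one point close to it, and then
    the induction hypothesis applies. *)
Lemma card_above_locally_constant A t0 (rs : seq R) (c : R) : closed_up A -> ~ bad A t0 ->
  ~ A t0 c -> path.sorted <%R rs -> (forall r, (A t0 r /\ c < r) <-> r \in rs) ->
  exists d : R, 0 < d /\ forall s, `|s - t0| < d ->
    forall N, card_le (fun r => A s r /\ c < r) N <-> (size rs <= N)%N.
Proof.
move=> cA nbad.
have pa r (e : R) : A t0 r -> 0 < e ->
    exists d : R, 0 < d /\ forall s, `|s - t0| < d -> exists r', A s r' /\ `|r' - r| < e.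
  move=> Ar e0; apply: contrapT => n; apply: nbad; left; exists r; split=> //.
  exists e; split=> // d d0; apply: contrapT => n'; apply: n; exists d; split=> // s sd.
  by apply: contrapT => n''; apply: n'; exists s; split=> // r' Ar' re; apply: n''; exists r'.
have pb r : A t0 r -> exists e d : R, [/\ 0 < e, 0 < d & forall s, `|s - t0| < d ->
    forall r' r'', A s r' -> A s r'' -> `|r' - r| < e -> `|r'' - r| < e -> r' = r''].
  move=> Ar; apply: contrapT => n; apply: nbad; right; left; exists r; split=> // e d e0 d0.
  apply: contrapT => n'; apply: n; exists e, d; split=> // s sd r' r'' A1 A2 n1 n2.
  by apply: contrapT => n3; apply: n'; exists s, r', r''.
have pc c' d' : c' <= d' -> (forall r, A t0 r -> ~ (c' <= r /\ r <= d')) ->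
    exists d : R, 0 < d /\ forall s, `|s - t0| < d -> forall r, A s r -> ~ (c' <= r /\ r <= d').
  move=> cd gap; apply: contrapT => n; apply: nbad; right; right; exists c', d'; split=> //.
  split=> // e e0; apply: contrapT => n'; apply: n; exists e; split=> // s se r Ar cr.
  by apply: n'; exists s; split=> //; exists r.
elim: rs c => [|r rs IH] c nc.
  move=> _ hr; have [||d [d0 hd]] := pc c (Num.max c 1); first by rewrite le_max lexx.
    move=> r Ar [cr _]; have /hr : A t0 r /\ c < r; last by [].
    by split=> //; rewrite lt_neqAle cr andbT; apply/eqP => e; apply: nc; rewrite e.
  exists d; split=> // s sd N; split=> // _; exists [::]; split=> // r [Ar cr].
  exfalso; apply: (hd s sd r Ar); split; first exact: ltW.
  by rewrite le_max; apply/orP; right; have [_ [_ /(_ r Ar)[]]] := cA s.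
move=> /= srt hr.
have rmin : forall x, x \in rs -> r < x by apply/allP; apply: order_path_min srt; apply: lt_trans.
have [Ar cr] : A t0 r /\ c < r by apply/hr; rewrite mem_head.
have [e [db [e0 db0 hb]]] := pb r Ar.
have [g [g0 hg]] := pos_below_seq (map (fun x => x - r) rs).
have [e1 [e10 e1e e1g]] := min_pos2 e0 g0.
have [e2 [e20 e2e e2c]] := min_pos2 e10 (ltac:(lra) : 0 < r - c).
have below x : x \in rs -> r + e2 / 2 < x.
  by move=> xrs; have := hg _ (map_f (fun y => y - r) xrs); have := rmin x xrs; lra.
have nc2 : ~ A t0 (r + e2 / 2).
  move=> Ac; have /hr : A t0 (r + e2 / 2) /\ c < r + e2 / 2 by split=> //; lra.
  by rewrite inE => /orP[/eqP|/below]; lra.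
have [||d1 [d10 hd1]] := IH (r + e2 / 2) nc2; first exact: path_sorted srt.
  move=> x; split=> [[Ax xe]|xrs]; last first.
    by split; [apply: (proj1 ((hr x).2 _)); rewrite inE xrs orbT|apply: below].
  have /hr : A t0 x /\ c < x by split=> //; lra.
  by rewrite inE => /orP[/eqP|//]; lra.
have [d2 [d20 hd2]] := pa r (e2 / 2) Ar ltac:(lra).
have [||d3 [d30 hd3]] := pc c (r - e2 / 2); first by lra.
  move=> x Ax [cx xr]; have /hr : A t0 x /\ c < x.
    by split=> //; rewrite lt_neqAle cx andbT; apply/eqP => ee; apply: nc; rewrite ee.
  by rewrite inE => /orP[/eqP|/below]; lra.
have [d4 [d40 d41 d42]] := min_pos2 d10 d20.
have [d5 [d50 d53 d5b]] := min_pos2 d30 db0.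
have [d6 [d60 d64 d65]] := min_pos2 d40 d50.
exists d6; split=> // s sd N.
have [r' [Ar' rr']] := hd2 s ltac:(lra).
have ub x : A s x -> c < x -> x <= r + e2 / 2 -> x = r'.
  move=> Ax cx xr; have n3 := hd3 s (lt_le_trans sd (le_trans d65 d53)) x Ax.
  have xr2 : r - e2 / 2 < x by rewrite ltNge; apply/negP => xx; apply: n3; split=> //; exact: ltW.
  apply: (hb s (lt_le_trans sd (le_trans d65 d5b)) x r' Ax Ar'); last first.
    by apply: lt_le_trans rr' _; clear -e2e e1e e20; lra.
  by rewrite ltr_norml; apply/andP; lra.
move: rr'; rewrite ltr_norml => /andP[rr1 rr2].
have eqv x : (A s x /\ c < x) /\ x <> r' <-> A s x /\ r + e2 / 2 < x.
  split=> [[[Ax cx] xr]|[Ax xr]].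
    by split=> //; rewrite ltNge; apply/negP => xx; apply: xr; apply: ub.
  by split; [split=> //; lra|lra].
have Pr' : A s r' /\ c < r' by split=> //; lra.
case: N => [|N].
  by split=> // -[L [/=]]; rewrite leqn0 size_eq0 => /eqP -> /(_ r' Pr').
rewrite (card_le_cons N Pr') /= ltnS -(hd1 s (lt_le_trans sd (le_trans d64 d41)) N).
by split; apply: card_le_sub => x /eqv.
Qed.

Lemma card_locally_constant A t0 : closed_up A -> fin (A t0) -> ~ bad A t0 ->
  exists d : R, 0 < d /\ forall s, `|s - t0| < d ->
    forall N, card_le (A s) N <-> card_le (A t0) N.
Proof.
move=> cA [L hL] nbad.
pose rs := sort <=%R (undup [seq r <- L | `[<A t0 r>]]).
have low s r : A s r -> -2 < r by have [_ [_ h]] := cA s; move=> /h; lra.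
have memrs r : (A t0 r /\ -2 < r) <-> r \in rs.
  rewrite mem_sort mem_undup mem_filter; split=> [[Ar _]|/andP[/asboolP Ar _]].
    by rewrite hL // andbT; apply/asboolP.
  by split=> //; apply: low Ar.
have srt : path.sorted <%R rs by rewrite sort_lt_sorted undup_uniq.
have n2 : ~ A t0 (-2) by move=> /low; lra.
have [d [d0 hd]] := card_above_locally_constant cA nbad n2 srt memrs.
exists d; split=> // s sd N.
have e x : card_le (A x) N <-> card_le (fun r => A x r /\ -2 < r) N.
  by split; apply: card_le_sub => r; [case|move=> Ar; split=> //; apply: low Ar].
by rewrite !e !hd // subrr normr0.
Qed.

Lemma card_constant A (a b : R) N : Def S (fun z : R * R => A z.1 z.2) -> closed_up A ->
  (forall t, fin (A t)) -> (forall t, a < t -> t < b -> ~ bad A t) ->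
  forall t t', a < t -> t < b -> a < t' -> t' < b -> card_le (A t) N -> card_le (A t') N.
Proof.
move=> dA cA finA good; apply: (@locally_constant _ S).
  exact: (Def_card_le (P := fun z => A z.1 z.2)).
move=> t at_ tb; have [d [d0 hd]] := card_locally_constant cA (finA t) (good t at_ tb).
by exists d; split=> // s sd; apply: hd.
Qed.

End Covering.

Section UniformFiniteness.
Set Implicit Arguments.
Unset Strict Implicit.
Unset Printing Implicit Defensive.
Local Open Scope classical_set_scope.
Local Open Scope ring_scope.

Variables (R : rcfType) (S : ominimal_structure R).
Implicit Types E F : dtype R.

Definition uniformly_finite E := forall A : E * R -> Prop, Def S A ->
  (forall x, fin (fun t => A (x, t))) -> exists N, forall x, card_le (fun t => A (x, t)) N.

(** Injectivity of the function taking [r] to [r / (1 + `|r|)], which compresses the line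
    into the open interval from -1 to 1. *)
Lemma squeeze_inj (u r r' : R) : u * (1 + `|r|) = r -> u * (1 + `|r'|) = r' -> r = r'.
Proof.
move=> e e'.
have : r * (1 + `|r'|) = r' * (1 + `|r|) by rewrite -{1}e -{2}e'; ring.
have n : 0 < 1 + `|r| by rewrite ltr_wpDr.
have n' : 0 < 1 + `|r'| by rewrite ltr_wpDr.
have [r0|r0] := leP 0 r; have [r'0|r'0] := leP 0 r'.
- by rewrite !ger0_norm //; lra.
- have : u < 0 by rewrite -(pmulr_llt0 _ n') e'.
  by rewrite ltNge -(pmulr_lge0 _ n) e r0.
- have : u < 0 by rewrite -(pmulr_llt0 _ n) e.
  by rewrite ltNge -(pmulr_lge0 _ n') e' r'0.
- by rewrite !ltr0_norm //; lra.
Qed.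

(** For fixed [x], the cardinality of the fibres is constant between consecutive bad values
    of the last parameter. So every cardinality that occurs over [x] already occurs at a bad value,
    at a midpoint of two of them, one step to the side of one of them, or at 0. The union
    of the fibres at these finitely many values is a finite set, and these
    unions form a family over [E]. *)
Lemma uniformly_finite_step E : uniformly_finite E -> uniformly_finite (pair_dtype E (scalar_dtype R)).
Proof.
move=> IH A dA finA.
pose B (z : E * R * R) := (exists r : R, A (z.1, r) /\ z.2 * (1 + `|r|) = r) \/ (z.2 = 1 \/ z.2 = -1).
have dB : Def S B by rewrite /B; def_auto.
have cB x : closed_up (fun t r => B (x, t, r)).
  move=> t; split; first by right; left.
  split; first by right; right.
  move=> u [[r [/= _ e]]|[/= ->|/= ->]]; [|lra|lra].
  have n : 0 < 1 + `|r| by rewrite ltr_wpDr.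
  apply/andP; rewrite -ler_norml -(ler_pM2r n) mul1r -{1}(ger0_norm (ltW n)) -normrM e; lra.
have finB x t : fin (fun u => B (x, t, u)).
  have [L hL] := finA (x, t).
  exists (1 :: -1 :: map (fun r => r / (1 + `|r|)) L) => u; rewrite !inE.
  move=> [[r [/= Ar e]]|[/= ->|/= ->]]; rewrite ?eqxx ?orbT //.
  have n : 1 + `|r| != 0 by rewrite gt_eqF // ltr_wpDr.
  by rewrite -(mulfK n u) e (map_f (fun r => r / (1 + `|r|))) ?hL ?orbT.
pose badB (z : E * R) := bad (fun t r => B (z.1, t, r)) z.2.
have dbad : Def S badB.
  rewrite /badB /bad /point_lost /points_collide /point_born; clearbody B; def_auto.
have dBx x : Def S (fun z : R * R => B (x, z.1, z.2)) by clearbody B; def_auto.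
have finbad x : fin (fun t => badB (x, t)).
  by apply: (bad_fin (dBx x) (cB x)) => t; apply: finB.
pose rep (z : E * R) := z.2 = 0 \/ exists b b' : R, (badB (z.1, b) /\ badB (z.1, b')) /\
  (z.2 = 2^-1 * (b + b') \/ (z.2 = b + 1 \/ z.2 = b - 1)).
have drep : Def S rep by clearbody badB; rewrite /rep; def_auto.
have finrep x : fin (fun t => rep (x, t)).
  have [L hL] := finbad x.
  exists (0 :: map (fun b => b + 1) L ++ map (fun b => b - 1) L ++
    [seq 2^-1 * (b + b') | b <- L, b' <- L]) => t.
  rewrite inE !mem_cat => -[/= ->|]; first by rewrite eqxx.
  move=> [b [b' [[/hL bL /hL bL'] [/= ->|[/= ->|/= ->]]]]].
  - by rewrite (allpairs_f (fun b b' => 2^-1 * (b + b'))) ?orbT.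
  - by rewrite (map_f (fun b => b + 1)) ?orbT.
  - by rewrite (map_f (fun b => b - 1)) ?orbT.
pose A' (z : E * R) := exists t : R, rep (z.1, t) /\ B (z.1, t, z.2).
have dA' : Def S A' by clearbody B rep; rewrite /A'; def_auto.
have [N hN] : exists N, forall x, card_le (fun u => A' (x, u)) N.
  apply: IH => // x; exact: (fin_bigunion (finrep x) (finB x)).
exists N => -[x t].
have {hN}hN t' : rep (x, t') -> card_le (fun u => B (x, t', u)) N.
  by move=> h; apply: card_le_sub (hN x) => u Bu; exists t'.
suff : card_le (fun u => B (x, t, u)) N.
  apply: (card_le_image (r := fun r u => u * (1 + `|r|) = r)); last first.
    by move=> r r' u; apply: squeeze_inj.
  move=> r Ar; exists (r / (1 + `|r|)).
  have n : 1 + `|r| != 0 by rewrite gt_eqF // ltr_wpDr.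
  by split; [left; exists r; split=> //=|]; rewrite mulfVK.
have cst t' a b : rep (x, t') -> a < t' -> t' < b -> a < t -> t < b ->
    (forall s, a < s -> s < b -> ~ badB (x, s)) -> card_le (fun u => B (x, t, u)) N.
  move=> r at' tb' at_ tb gd.
  by apply: (card_constant (dBx x) (cB x) (finB x) gd at' tb' at_ tb); apply: hN.
have [bt|nbt] := pselect (badB (x, t)).
  by apply: hN; right; exists t, t; split=> //; left; rewrite /=; lra.
have sep s l : badB (x, s) -> (forall y, badB (x, y) -> y < t -> y <= l) -> l < s -> t < s.
  move=> bs hl ls; have [//|st|e] := ltgtP t s; last by rewrite -e in bs.
  by have := hl s bs st; lra.
have [hl|hl] := pselect (exists l, badB (x, l) /\ l < t); last first.
  have nol s : badB (x, s) -> t < s.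
    move=> bs; have [//|st|e] := ltgtP t s; first by case: hl; exists s.
    by rewrite -e in bs.
  have [hu|hu] := pselect (exists u, badB (x, u) /\ t < u); last first.
    apply: (cst 0 (Num.min t 0 - 1) (Num.max t 0 + 1)); first by left.
    - by case: (leP t 0); lra.
    - by case: (leP t 0); lra.
    - by case: (leP t 0); lra.
    - by case: (leP t 0); lra.
    - by move=> s _ _ bs; apply: hu; exists s; split=> //; apply: nol.
  have [u [bu tu hu']] := fin_next (finbad x) hu.
  apply: (cst (u - 1) (Num.min t (u - 1) - 1) u) => //.
  - by right; exists u, u; split=> //; right; right.
  - by case: (leP t (u - 1)); lra.
  - by lra.
  - by case: (leP t (u - 1)); lra.
  - by move=> s _ su bs; have := hu' s bs (nol s bs); lra.
have [l [bl lt_ hl']] := fin_prev (finbad x) hl.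
have [hu|hu] := pselect (exists u, badB (x, u) /\ t < u); last first.
  apply: (cst (l + 1) l (Num.max t (l + 1) + 1)) => //.
  - by right; exists l, l; split=> //; right; left.
  - by lra.
  - by case: (leP t (l + 1)); lra.
  - by case: (leP t (l + 1)); lra.
  - by move=> s ls _ bs; apply: hu; exists s; split=> //; apply: sep ls.
have [u [bu tu hu']] := fin_next (finbad x) hu.
apply: (cst (2^-1 * (l + u)) l u) => //.
- by right; exists l, u; split=> //; left.
- by lra.
- by lra.
- by move=> s ls su bs; have := hu' s bs (sep s l bs hl' ls); lra.
Qed.

Lemma uniform_finiteness_row m : uniformly_finite (row_dtype R m).
Proof.
elim: m => [|m IH] A dA finA.
  have [s hs] := finA 0; exists (size s) => x; exists s; split=> // t.
  by rewrite (row0_eq x 0); apply: hs.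
have dA' : Def S (fun z : 'rV[R]_m * R * R => A (snoc z.1.1 z.1.2, z.2)) by def_auto.
have [|N hN] := uniformly_finite_step IH dA'; first by move=> x; exact: (finA (snoc x.1 x.2)).
by exists N; elim/snocP=> x t; apply: (hN (x, t)).
Qed.

Lemma uniform_finiteness E : uniformly_finite E.
Proof.
move=> A dA finA.
have dm : Dmap S (fun v : 'rV[R]_(ddim E) => dmk (fun i => v ord0 i) : E).
  exact: (@Dmap_reindex _ S (row_dtype R (ddim E)) E id).
pose m (v : 'rV[R]_(ddim E)) : E := dmk (fun i => v ord0 i).
have {}dm : Dmap S m by [].
have dA' : Def S (fun z : 'rV[R]_(ddim E) * R => A (m z.1, z.2)) by clearbody m; def_auto.
have [|N hN] := uniform_finiteness_row dA'; first by move=> x; exact: (finA (m x)).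
exists N => x; have := hN (\row_i dco x i); rewrite /= (_ : m _ = x) //.
by apply: dco_inj => i; rewrite dmkK mxE.
Qed.

(** One definable selection is removed at a time. *)
Lemma cover_by_graphs E (A : E * R -> Prop) : Def S A ->
  (forall x, fin (fun t => A (x, t))) ->
  exists N (f : 'I_N -> E -> R), (forall j, Dmap S (f j)) /\
    forall x t, A (x, t) -> exists j, t = f j x.
Proof.
move=> dA /(uniform_finiteness dA)[N]; exists N; elim: N A dA p => [|N IH] A dA hN.
  exists (fun _ _ => 0); split=> [[]//|x t At].
  by have [s [+ /(_ t At)]] := hN x; rewrite leqn0 size_eq0 => /eqP ->.
have [g [dg hg]] := definable_choice dA.
have dA' : Def S (fun z : E * R => A z /\ z.2 <> g z.1) by def_auto.
have [|f [df hf]] := IH _ dA'.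
  move=> x; have [[t At]|h] := pselect (exists t, A (x, t)).
    by apply/(card_le_cons N (hg x (ex_intro _ t At))); apply: hN.
  by exists [::]; split=> // t [At _]; case: h; exists t.
exists (fun j => if unlift ord0 j is Some i then f i else g); split.
  by move=> j; case: unliftP.
move=> x t At; have [e|ne] := pselect (t = g x).
  by exists ord0; rewrite unlift_none.
have [i ti] := hf x t (conj At ne).
by exists (lift ord0 i); rewrite liftK.
Qed.

End UniformFiniteness.

(** * Piecewise continuity in families *)

Section PiecewiseContinuity.
Set Implicit Arguments.
Unset Strict Implicit.
Unset Printing Implicit Defensive.
Local Open Scope classical_set_scope.
Local Open Scope ring_scope.

Variables (R : rcfType) (S : ominimal_structure R).
Implicit Types E F Y : dtype R.

Definition nonexpansive m n (q : 'rV[R]_m -> 'rV[R]_n) :=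
  forall x x' d, near x x' d -> near (q x) (q x') d.

(** On each fibre of such a set, points are determined by fewer coordinates. *)
Definition thin k Y (P : 'rV[R]_k * Y -> Prop) := Def S P /\
  exists n (q : 'rV[R]_k -> 'rV[R]_n), [/\ (n < k)%N, Dmap S q, nonexpansive q &
    forall x x' y, P (x, y) -> P (x', y) -> q x = q x' -> x = x'].

(** Over a point of the base, the fibre of [X] in the last variable consists of finitely
    many isolated or boundary points, on which the last coordinate is redundant,
    and of interior points, which occur only over a set with empty interior again. *)
Lemma empty_interior_thin k Y (X : 'rV[R]_k * Y -> Prop) : Def S X ->
  (forall y p (d : R), 0 < d -> ~ (forall x, near p x d -> X (x, y))) ->
  exists (I : finType) (P : I -> 'rV[R]_k * Y -> Prop),
    (forall j, thin (P j)) /\ forall z, X z -> exists j, P j z.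
Proof.
elim: k X => [|k IH] X dX hX.
  exists void, (fun _ _ => False); split=> [[]|[x y] Xxy]; exfalso.
  by apply: (hX y x 1) => // x' _; rewrite (row0_eq x' x).
pose Fi (z : 'rV[R]_k * Y * R) := X (snoc z.1.1 z.2, z.1.2) /\
  ~ exists e : R, 0 < e /\ forall s : R, `|s - z.2| < e -> X (snoc z.1.1 s, z.1.2).
have dFi : Def S Fi by rewrite /Fi; def_auto.
have finFi z : fin (fun t => Fi (z, t)).
  have dFz : Def S (fun t : R => Fi (z, t)) by clearbody Fi; def_auto.
  have [//|[a [b [ab h]]]] := fin_or_interval dFz; exfalso.
  have [||_ n] := h ((a + b) / 2); [lra|lra|].
  apply: n; exists ((b - a) / 2); split; first by lra.
  by move=> s /=; rewrite ltr_norml => /andP[? ?]; have [||] := h s; lra || done.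
have [N [f [df hf]]] := cover_by_graphs dFi finFi.
pose B (z : 'rV[R]_k * Y) := exists c e : R, 0 < e /\
  forall t : R, `|t - c| < e -> X (snoc z.1 t, z.2).
have dB : Def S B by rewrite /B; def_auto.
have [|I [P [thP hP]]] := IH B dB.
  move=> y p d d0 h.
  pose Q (z : 'rV[R]_k * R * R) := forall t : R, `|t - z.1.2| < z.2 -> X (snoc z.1.1 t, y).
  have dQ : Def S Q by rewrite /Q; def_auto.
  have exQ x : near p x d -> exists c e : R, 0 < e /\ Q (x, c, e) by move=> /h.
  have [|p' [d' [c [e [d'0 e0 h']]]]] :=
    uniform_interval (@generic_continuity _ S k) dQ d0 exQ.
    by move=> x c c' e e' h1 e0 ce t /= te; apply: h1; apply: abs_recenter te ce.
  have [r [r0 rd re]] := min_pos2 d'0 e0.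
  apply: (hX y (snoc p' c) r r0); elim/snocP => x t /near_snoc[xr tr].
  have [_] := h' x (near_le rd xr); apply => /=.
  by rewrite distrC; apply: lt_le_trans re.
exists ('I_N + I)%type, (fun j (z : 'rV[R]_k.+1 * Y) => match j with
  | inl i => z.1 ord0 ord_max = f i (init z.1, z.2) | inr i => P i (init z.1, z.2) end).
split=> [[i|i]|].
- split; first by def_auto.
  exists k, (@init R k); split=> //.
  + exact: Dmap_init (Dmap_id _ _).
  + by elim/snocP=> x t; elim/snocP=> x' t' d /near_snoc[]; rewrite !init_snoc.
  + elim/snocP=> x t; elim/snocP=> x' t' y /=; rewrite !init_snoc !last_snoc.
    by move=> -> -> ->.
- have [dP [n [q [nk dq ne inj]]]] := thP i.
  split; first by def_auto.
  exists n.+1, (fun z => snoc (q (init z)) (z ord0 ord_max)); split=> //.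
  + by def_auto.
  + elim/snocP=> x t; elim/snocP=> x' t' d /near_snoc[h1 h2].
    by rewrite !init_snoc !last_snoc near_snoc; split=> //; apply: ne.
  + elim/snocP=> x t; elim/snocP=> x' t' y /=; rewrite !init_snoc !last_snoc.
    move=> P1 P2 e; have e1 := congr1 (@init R n) e; have e2 := congr1 (fun z : 'rV_n.+1 => z ord0 ord_max) e.
    by rewrite !init_snoc !last_snoc in e1 e2; rewrite (inj _ _ _ P1 P2 e1) e2.
move=> [z y]; elim/snocP: z => x t Xz.
have [h|h] := pselect (exists e : R, 0 < e /\ forall s : R, `|s - t| < e -> X (snoc x s, y)).
  have [|j Pj] := hP (x, y); first by exists t.
  by exists (inr j); rewrite init_snoc.
have [j e] := hf (x, y) t (conj Xz h).
by exists (inl j); rewrite /= init_snoc last_snoc.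
Qed.

Definition cont_on m (X : 'rV[R]_m -> Prop) (f : 'rV[R]_m -> R) :=
  forall x, X x -> forall e : R, 0 < e -> exists d : R, 0 < d /\
    forall x', X x' -> near x x' d -> `|f x' - f x| < e.

(** The discontinuity set has empty interior, hence is thin; on a thin piece [f]
    factors through fewer variables. *)
Lemma piecewise_continuity k Y (f : 'rV[R]_k * Y -> R) : Dmap S f ->
  exists (I : finType) (P : I -> 'rV[R]_k * Y -> Prop),
  [/\ forall i, Def S (P i), forall z, exists i, P i z &
     forall i y, cont_on (fun x => P i (x, y)) (fun x => f (x, y))].
Proof.
elim/ltn_ind: k f => k IH f df.
pose D (z : 'rV[R]_k * Y) := ~ contat (fun x => f (x, z.2)) z.1.
have dD : Def S D by rewrite /D /contat; def_auto.
have [|J [T [thT hT]]] := empty_interior_thin dD.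
  move=> y p d d0 h.
  have dfy : Dmap S (fun x => f (x, y)) by def_auto.
  have [p' [d' [d'0 h']]] := generic_continuity dfy p d0.
  by have [/h] := h' p' (near_refl _ d'0).
have ex j : exists D : {I : finType & I -> 'rV[R]_k * Y -> Prop},
    [/\ forall i, Def S (projT2 D i), forall z, T j z -> exists i, projT2 D i z &
     forall i y, cont_on (fun x => projT2 D i (x, y)) (fun x => f (x, y))].
  have [dT [n [q [nk dq ne inj]]]] := thT j.
  pose G (z : 'rV[R]_n * Y * R) := exists x, T j (x, z.1.2) /\ (q x = z.1.1 /\ z.2 = f (x, z.1.2)).
  have dG : Def S G by move: (T j) dT => Tj dTj in G *; rewrite /G; def_auto.
  have [|g [dg hg]] := Dmap_unique dG.
    move=> [u y] t t' [x [Tx /= [qx ->]]] [x' [Tx' /= [qx' ->]]].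
    by rewrite (inj x x' y) // qx qx'.
  have {}hg x y : T j (x, y) -> g (q x, y) = f (x, y) by move=> Tx; apply: hg; exists x.
  have [I [P [dP cP contP]]] := IH n nk g dg.
  exists (existT (fun I : finType => I -> 'rV[R]_k * Y -> Prop) I
    (fun i z => T j z /\ P i (q z.1, z.2))); split=> /=.
  - by move=> i; move: (T j) dT => Tj dTj; def_auto.
  - by move=> [x y] Tx; have [i Pi] := cP (q x, y); exists i.
  - move=> i y x [Tx Px] e e0; have [d [d0 hd]] := contP i y _ Px e e0.
    by exists d; split=> // x' [Tx' Px'] /ne xx; rewrite -!hg //; apply: hd.
have [C hC] := choice ex.
exists (option {j : J & projT1 (C j)}), (fun o z => match o with
  | None => ~ D z | Some (existT j i) => projT2 (C j) i z end); split.
- by move=> [[j i]|]; [have [dC _ _] := hC j; apply: dC|apply: Def_not].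
- move=> z; have [/hT[j Tz]|n] := pselect (D z); last by exists None.
  by have [_ /(_ z Tz)[i h] _] := hC j; exists (Some (existT (fun j => projT1 (C j)) j i)).
- move=> [[j i]|] y; first by have [_ _ h] := hC j; apply: h.
  move=> x /contrapT c e /c[d [d0 hd]].
  by exists d; split=> // x' _; apply: hd.
Qed.

Lemma cont_on_within m (X : set 'rV[R]_m) (f : 'rV[R]_m -> R) :
  cont_on X f -> {within X, continuous f}.
Proof.
move=> h; apply/subspace_continuousP => x Xx; apply/cvgrPdist_lt => e e0.
have [d [d0 hd]] := h x Xx e e0.
rewrite near_withinE; apply/nbhs_ballP; exists d => //= y xy Xy.
have nxy : near x y d by move=> i; case: xy => _ /(_ ord0 i); rewrite -ball_normE.
by rewrite distrC; apply: hd.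
Qed.

End PiecewiseContinuity.

(** * Points and gaps of a finite family of reals *)

Section Gaps.
Set Implicit Arguments.
Unset Strict Implicit.
Unset Printing Implicit Defensive.
Local Open Scope classical_set_scope.
Local Open Scope ring_scope.

Variables (R : rcfType) (P : finType).
Implicit Types (g : P -> R) (p q r : P) (kd : bool * bool).

(** A pair of booleans tells which ends of a band are bounded; the remaining pair
    [(false, false)] stands for a graph. A set with a single bound has it at [a]. *)
Definition in_piece kd (a b t : R) : Prop :=
  match kd with
  | (true, true) => a < t /\ t < b
  | (true, false) => a < t
  | (false, true) => t < a
  | (false, false) => a = t
  end.

(** Among indices with equal values only the first in the enumeration is used, so that every
    point and every gap is described once. *)
Definition first_rep g p := forall r, (enum_rank r < enum_rank p)%N -> g r <> g p.

Definition piece_ok g kd p q : Prop :=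
  match kd with
  | (true, true) => [/\ first_rep g p, first_rep g q, g p < g q &
                        forall r, ~ (g p < g r /\ g r < g q)]
  | (true, false) => first_rep g p /\ forall r, ~ g p < g r
  | (false, true) => first_rep g p /\ forall r, ~ g r < g p
  | (false, false) => first_rep g p
  end.

Definition test_point kd (a b : R) : R :=
  match kd with
  | (true, true) => 2^-1 * (a + b)
  | (true, false) => a + 1
  | (false, true) => a - 1
  | (false, false) => a
  end.

Lemma first_rep_uniq g p q : first_rep g p -> first_rep g q -> g p = g q -> p = q.
Proof.
move=> fp fq e; apply: enum_rank_inj; apply/val_inj.
have [h|h|//] := ltngtP (enum_rank p) (enum_rank q).
  by case: (fq p h).
by case: (fp q h).
Qed.

Lemma first_rep_exists g r : exists p, first_rep g p /\ g p = g r.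
Proof.
have e0 : g r == g r by [].
case: (@arg_minnP P r (fun p => g p == g r) (fun p => nat_of_ord (enum_rank p)) e0).
move=> p /eqP pr hp; exists p; split=> // q qp e.
by have := hp q; rewrite e pr eqxx => /(_ isT); rewrite leqNgt qp.
Qed.

Lemma max_below g (t : R) r0 : g r0 < t -> exists p, [/\ first_rep g p, g p < t &
  forall r, g r < t -> g r <= g p].
Proof.
move=> r0t; case: (@Order.TotalTheory.arg_maxP _ R P r0 (fun r => g r < t) g r0t) => p pt hp.
have [q [fq e]] := first_rep_exists g p.
by exists q; split=> //; rewrite e // => r /hp.
Qed.

Lemma min_above g (t : R) r0 : t < g r0 -> exists p, [/\ first_rep g p, t < g p &
  forall r, t < g r -> g p <= g r].
Proof.
move=> r0t; case: (@Order.TotalTheory.arg_minP _ R P r0 (fun r => t < g r) g r0t) => p pt hp.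
have [q [fq e]] := first_rep_exists g p.
by exists q; split=> //; rewrite e // => r /hp.
Qed.

Lemma piece_cover g (t : R) p0 : exists kd p q,
  [/\ piece_ok g kd p q, in_piece kd (g p) (g q) t & kd <> (true, true) -> q = p].
Proof.
have [[r e]|ne] := pselect (exists r, g r = t).
  by have [p [fp ep]] := first_rep_exists g r; exists (false, false), p, p; rewrite /= ep.
have [[a ha]|na] := pselect (exists r, g r < t); last first.
  have [|p [fp tp hp]] := @min_above g t p0.
    by case: (ltgtP t (g p0)) => // h; [case: na|case: ne]; exists p0.
  exists (false, true), p, p; split=> //; split=> // r rp.
  have := hp r; case: (ltgtP t (g r)) => [_ /(_ isT)|h _|h _]; first by lra.
    by apply: na; exists r.
  by apply: ne; exists r.
have [p [fp pt hp]] := max_below ha.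
have [[b hb]|nb] := pselect (exists r, t < g r); last first.
  exists (true, false), p, p; split=> //; split=> // r rp.
  have := hp r; case: (ltgtP t (g r)) => [h _|_ /(_ isT)|h _]; last by apply: ne; exists r.
    by apply: nb; exists r.
  by lra.
have [q [fq tq hq]] := min_above hb.
exists (true, true), p, q; split=> //; split=> //; first by lra.
move=> r [pr rq]; have [h|h|h] := ltgtP t (g r); last by apply: ne; exists r.
  by have := hq r h; lra.
by have := hp r h; lra.
Qed.

Lemma piece_disjoint g kd kd' p q p' q' (t : R) :
  piece_ok g kd p q -> in_piece kd (g p) (g q) t -> (kd <> (true, true) -> q = p) ->
  piece_ok g kd' p' q' -> in_piece kd' (g p') (g q') t -> (kd' <> (true, true) -> q' = p') ->
  [/\ kd = kd', p = p' & q = q'].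
Proof.
move=> + + e + + e'.
suff h : piece_ok g kd p q -> in_piece kd (g p) (g q) t -> piece_ok g kd' p' q' ->
    in_piece kd' (g p') (g q') t -> [/\ kd = kd', p = p' & kd = (true, true) -> q = q'].
  move=> h1 h2 h3 h4; have [E1 E2 E3] := h h1 h2 h3 h4; split=> //.
  have [E|E] := pselect (kd = (true, true)); first exact: E3.
  by rewrite e // e' // -E1.
case: kd {e} => [[] []]; case: kd' {e'} => [[] []] /=.
- move=> [f1 f2 pq h] [t1 t2] [f1' f2' pq' h'] [t1' t2'].
  have ep : g p = g p'.
    have [l|l|//] := ltgtP (g p) (g p'); first by case: (h p'); split=> //; lra.
    by case: (h' p); split=> //; lra.
  have eq_ : g q = g q'.
    have [l|l|//] := ltgtP (g q) (g q'); first by case: (h' q); split=> //; lra.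
    by case: (h q'); split=> //; lra.
  by split=> // [|_]; [apply: first_rep_uniq ep|apply: first_rep_uniq eq_].
- by move=> [f1 f2 pq h] [t1 t2] [f1' h'] t1'; exfalso; apply: (h' q); lra.
- by move=> [f1 f2 pq h] [t1 t2] [f1' h'] t1'; exfalso; apply: (h' p); lra.
- by move=> [f1 f2 pq h] [t1 t2] f1' e; exfalso; apply: (h p'); lra.
- by move=> [f1' h'] t1' [f1 f2 pq h] [t1 t2]; exfalso; apply: (h' q'); lra.
- move=> [f1 h] t1 [f1' h'] t1'; split=> //; apply: (first_rep_uniq (g := g)) => //.
  by have [/h|/h'|] := ltgtP (g p) (g p').
- by move=> [f1 h] t1 [f1' h'] t1'; exfalso; apply: (h p'); lra.
- by move=> [f1 h] t1 f1' e; exfalso; apply: (h p'); lra.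
- by move=> [f1' h'] t1' [f1 f2 pq h] [t1 t2]; exfalso; apply: (h' p'); lra.
- by move=> [f1 h] t1 [f1' h'] t1'; exfalso; apply: (h p'); lra.
- move=> [f1 h] t1 [f1' h'] t1'; split=> //; apply: (first_rep_uniq (g := g)) => //.
  by have [/h'|/h|] := ltgtP (g p) (g p').
- by move=> [f1 h] t1 f1' e; exfalso; apply: (h p'); lra.
- by move=> f1' e [f1 f2 pq h] [t1 t2]; exfalso; apply: (h p); lra.
- by move=> f1' e [f1 h] t1; exfalso; apply: (h p); lra.
- by move=> f1' e [f1 h] t1; exfalso; apply: (h p); lra.
- by move=> f1 e f1' e'; split=> //; apply: (first_rep_uniq (g := g)) => //; lra.
Qed.

Lemma piece_right_end g kd p q q' : piece_ok g kd p q -> (kd <> (true, true) -> q = p) ->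
  piece_ok g kd p q' -> (kd <> (true, true) -> q' = p) -> q = q'.
Proof.
case: kd => [[] []] /=; try by move=> _ h _ h'; rewrite h // h'.
move=> [_ fq pq h] _ [_ fq' pq' h'] _; apply: (first_rep_uniq fq fq').
have [l|l|//] := ltgtP (g q) (g q'); first by case: (h' q).
by case: (h q').
Qed.

Lemma piece_ok_ext g g' kd p q :
  (forall r, (g p < g r <-> g' p < g' r) /\ (g r < g p <-> g' r < g' p)) ->
  (forall r, (g q < g r <-> g' q < g' r) /\ (g r < g q <-> g' r < g' q)) ->
  piece_ok g kd p q -> piece_ok g' kd p q.
Proof.
move=> hp hq.
have fr s : (forall r, (g s < g r <-> g' s < g' r) /\ (g r < g s <-> g' r < g' s)) ->
    first_rep g s -> first_rep g' s.
  move=> hs fs r rs e; apply: (fs r rs); have [h1 h2] := hs r.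
  by have [/h2|/h1|//] := ltgtP (g r) (g s); rewrite e ltxx.
case: kd => [[] []] /=.
- move=> [f1 f2 pq h]; split; [exact: fr|exact: fr|by apply/(hp q).1|].
  by move=> r [h1 h2]; apply: (h r); split; [apply/(hp r).1|apply/(hq r).2].
- by move=> [f1 h]; split; [exact: fr|move=> r /(hp r).1; apply: h].
- by move=> [f1 h]; split; [exact: fr|move=> r /(hp r).2; apply: h].
- exact: fr.
Qed.

(** The interval from [a] to [b] is the gap itself, or if that is unbounded, a part of it
    reaching beyond both points. *)
Lemma piece_gap g kd p q (t : R) : piece_ok g kd p q -> in_piece kd (g p) (g q) t ->
  t = test_point kd (g p) (g q) \/ exists a b : R,
  [/\ a < t /\ t < b, a < test_point kd (g p) (g q) /\ test_point kd (g p) (g q) < b &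
      forall s r, a < s -> s < b -> s <> g r].
Proof.
case: kd => [[] []] /=.
- move=> [_ _ pq h] [t1 t2]; right; exists (g p), (g q); split; [lra|lra|].
  by move=> s r ps sq e; apply: (h r); rewrite -e.
- move=> [_ h] pt; right; exists (g p), (Num.max t (g p + 1) + 1).
  split; [by case: (leP t (g p + 1)); lra|by case: (leP t (g p + 1)); lra|].
  by move=> s r ps _ e; apply: (h r); rewrite -e.
- move=> [_ h] pt; right; exists (Num.min t (g p - 1) - 1), (g p).
  split; [by case: (leP t (g p - 1)); lra|by case: (leP t (g p - 1)); lra|].
  by move=> s r _ ps e; apply: (h r); rewrite -e.
- by move=> _ ->; left.
Qed.

End Gaps.

(** * The inductive construction of the decomposition *)

Section Decomposition.
Set Implicit Arguments.
Unset Strict Implicit.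
Unset Printing Implicit Defensive.
Local Open Scope classical_set_scope.
Local Open Scope ring_scope.

Variables (R : rcfType) (S : ominimal_structure R).
Implicit Types Y : dtype R.

(** Extends the cylindrical sets by the one-point space, over which the cylindrical
    sets of the line are the graphs and the bands. *)
Definition cylindrical_from0 k : set 'rV[R]_k -> Prop :=
  match k with
  | 0 => fun C : set 'rV[R]_0 => C = setT
  | m.+1 => fun C : set 'rV[R]_m.+1 => cylindrical S C
  end.

Lemma cylindrical_from0_graph k (C : set 'rV[R]_k) xi :
  cylindrical_from0 C -> definable_continuous S C xi ->
  cylindrical_from0 (graph_over C xi).
Proof.
case: k C xi => [|k] C xi /= cC dc; last exact: cylindrical_graph.
rewrite (_ : graph_over C xi = [set x : 'rV[R]_1 | x ord0 ord0 = xi 0]).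
  exact: cylindrical_point.
rewrite predeqE => z; rewrite /graph_over /= cC (row0_eq (init z) 0) (ord1 ord_max).
by split=> [[_ ->]|->].
Qed.

Lemma cylindrical_from0_band k (C : set 'rV[R]_k) (xi1 xi2 : 'rV[R]_k -> \bar R) :
  cylindrical_from0 C -> band_bound S C -oo%E xi1 -> band_bound S C +oo%E xi2 ->
  (forall x, C x -> (xi1 x < xi2 x)%E) -> cylindrical_from0 (band_over C xi1 xi2).
Proof.
case: k C xi1 xi2 => [|k] C xi1 xi2 /= cC b1 b2 lt12; last exact: cylindrical_band.
rewrite (_ : band_over C xi1 xi2 =
  [set x : 'rV[R]_1 | open_interval (xi1 0) (xi2 0) (x ord0 ord0)]).
  by apply: cylindrical_interval; apply: lt12; rewrite cC.
rewrite predeqE => z; rewrite /band_over /open_interval /= cC (row0_eq (init z) 0) (ord1 ord_max).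
by split=> [[]|[]].
Qed.

Lemma fin_exists_fin (W : finType) (P : W -> R -> Prop) : (forall w, fin (P w)) ->
  fin (fun t => exists w, P w t).
Proof.
move=> /choice[q hq]; exists (flatten [seq q w | w <- enum W]) => t [w /hq tw].
by apply/flattenP; exists (q w) => //; apply: map_f; rewrite mem_enum.
Qed.

(** One more graph is thrown in, so that the family of graphs is not empty. *)
Lemma boundary_functions k Y (W : finType) (T : W -> 'rV[R]_k.+1 * Y -> Prop) :
  (forall w, Def S (T w)) ->
  exists N (f : 'I_N.+1 -> 'rV[R]_k * Y -> R), (forall j, Dmap S (f j)) /\
  forall w x y (t : R), (forall j, t <> f j (x, y)) -> exists e : R, 0 < e /\
    forall s : R, `|s - t| < e -> (T w (snoc x s, y) <-> T w (snoc x t, y)).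
Proof.
move=> dT.
pose B w (z : 'rV[R]_k * Y * R) := ~ exists e : R, 0 < e /\ forall s : R, `|s - z.2| < e ->
  (T w (snoc z.1.1 s, z.1.2) <-> T w (snoc z.1.1 z.2, z.1.2)).
have dB w : Def S (B w) by rewrite /B; def_auto.
have finB w z : fin (fun t => B w (z, t)).
  have dBz : Def S (fun t : R => B w (z, t)) by have := dB w; clearbody B => dBw; def_auto.
  have [//|[a [b [ab h]]]] := fin_or_interval dBz; exfalso.
  have dTz : Def S (fun t : R => T w (snoc z.1 t, z.2)) by def_auto.
  have [b' [ab' hb']] := germ_right a dTz.
  have [c [c0 cb cb']] := min_pos2 (ltac:(lra) : 0 < b - a) (ltac:(lra) : 0 < b' - a).
  apply: (h (a + c / 2)); [lra|lra|].
  exists (c / 2); split; first by lra.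
  move=> s /=; rewrite ltr_norml => /andP[? ?].
  by case: hb' => hb'; split=> h'; try (apply: hb'; lra); exfalso; move: h'; apply: hb'; lra.
have dBB : Def S (fun z => exists w, B w z).
  by apply: Def_exists_fin => w; apply: dB.
have [N [f [df hf]]] := cover_by_graphs dBB (fun z => fin_exists_fin (fun w => finB w z)).
exists N, (fun j => if unlift ord0 j is Some i then f i else fun _ => 0); split.
  by move=> j; case: unliftP => // _; apply: Dmap_const.
move=> w x y t ht; apply: contrapT => n.
have [|j e] := hf (x, y) t; first by exists w.
by apply: (ht (lift ord0 j)); rewrite liftK.
Qed.

Lemma Def_in_piece (E : dtype R) kd (a b t : E -> R) : Dmap S a -> Dmap S b -> Dmap S t ->
  Def S (fun z => in_piece kd (a z) (b z) (t z)).
Proof. by case: kd => [[] []] da db dt /=; def_auto. Qed.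

Lemma Dmap_test_point (E : dtype R) kd (a b : E -> R) : Dmap S a -> Dmap S b ->
  Dmap S (fun z => test_point kd (a z) (b z)).
Proof. by case: kd => [[] []] da db /=; def_auto. Qed.

Definition is_partition_of k (D : set (set 'rV[R]_k)) :=
  [/\ forall x, exists B, D B /\ B x, forall B, D B -> exists x, B x &
      forall B B' x, D B -> D B' -> B x -> B' x -> B = B'].

Definition enumerable_by k (D : set (set 'rV[R]_k)) (m : nat) :=
  exists e : 'I_m -> set 'rV[R]_k, forall B, D B -> exists c, B = e c.

Lemma enumerable_by_fin k (D : set (set 'rV[R]_k)) (F : finType) (e : F -> set 'rV[R]_k) m :
  #|F| = m -> (forall B, D B -> exists c, B = e c) -> enumerable_by D m.
Proof.
move=> <- h; exists (fun c => e (enum_val c)) => B /h[c ->].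
by exists (enum_rank c); rewrite enum_rankK.
Qed.

Lemma enumerable_by_le k (D : set (set 'rV[R]_k)) m m' : (m <= m')%N ->
  enumerable_by D m -> enumerable_by D m'.
Proof.
move=> mm [e he]; exists (fun c : 'I_m' => if insub (val c) is Some c' then e c' else set0).
move=> B /he[c ->]; exists (widen_ord mm c).
by rewrite (_ : val (widen_ord mm c) = val c) // valK.
Qed.

Lemma cylindrical_from0_full k (C : set 'rV[R]_k) : k = 0%N -> cylindrical_from0 C -> C = setT.
Proof. by move=> k0; move: C; rewrite k0. Qed.

Definition decomposable k := forall Y (W : finType) (T : W -> 'rV[R]_k * Y -> Prop),
  (forall w, Def S (T w)) ->
  exists (I : finType) (A : I -> 'rV[R]_k * ('I_(k.*2) -> Y) -> Prop) (C : nat),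
    (forall a, Def S (A a)) /\
    forall n (y : 'I_n -> Y), (0 < n)%N -> exists D : set (set 'rV[R]_k),
    [/\ forall B, D B -> exists a (i : 'I_(k.*2) -> 'I_n),
          B = [set x | A a (x, fun c => y (i c))],
        is_partition_of D,
        forall B, D B -> cylindrical_from0 B,
        forall B w i x x', D B -> B x -> B x' -> T w (x, y i) -> T w (x', y i) &
        enumerable_by D (C * n ^ (k.*2).-1)].

Lemma decomposable0 : decomposable 0.
Proof.
move=> Y W T dT; exists unit, (fun _ _ => True), 1%N; split; first by move=> a; apply: Def_const.
move=> n y n0; exists [set setT]; split.
- move=> B ->; exists tt, (fun _ => Ordinal n0); by rewrite predeqE.
- split; first by move=> x; exists setT.
    by move=> B ->; exists 0.
  by move=> B B' x -> ->.
- by move=> B ->.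
- by move=> B w i x x' _ _ _; rewrite (row0_eq x x').
- by apply: (@enumerable_by_fin _ _ unit (fun _ => setT)); [rewrite card_unit|move=> B ->; exists tt].
Qed.

(** The boundary points of all the sets [T_y] in the last variable lie on finitely many graphs
    [f j]. For a pair [p], [q] of the resulting functions on the base, the condition that they
    are consecutive is a condition on the pairs formed with each further function; hence for
    fixed [p] and [q] the induction hypothesis applies to only [n] points, which
    keeps the number of pieces down. *)
Lemma decomposable_step k : decomposable k -> decomposable k.+1.
Proof.
move=> IH Y W T dT.
have [N [f [df hf]]] := boundary_functions dT.
have ex j : exists E : {I : finType & I -> 'rV[R]_k * Y -> Prop},
    [/\ forall i, Def S (projT2 E i), forall z, exists i, projT2 E i z &
       forall i y, cont_on (fun x => projT2 E i (x, y)) (fun x => f j (x, y))].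
  have [I [P h]] := piecewise_continuity (df j).
  by exists (existT (fun I : finType => I -> 'rV[R]_k * Y -> Prop) I P).
have {ex}[E hE] := choice ex.
(* Over the parameters [y1], [y2], [y3], the first two provide the ends of a piece. The
   sets say: how an end compares with a further function, that a function lies in one of its
   domains of continuity, and that the test point of a piece belongs to a given set. *)
pose W' := (bool * bool * 'I_N.+1 * 'I_N.+1 + {j : 'I_N.+1 & projT1 (E j)} +
  bool * bool * 'I_N.+1 * 'I_N.+1 * W)%type.
pose T' (o : W') (z : 'rV[R]_k * (Y * Y * Y)) : Prop := match o with
  | inl (inl (a, b, j, j')) =>
      let u := f j (z.1, if a then z.2.1.1 else z.2.1.2) in
      let v := f j' (z.1, z.2.2) in if b then u < v else v < u
  | inl (inr (existT j i)) => projT2 (E j) i (z.1, z.2.2)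
  | inr (kd, j, j', w) =>
      T w (snoc z.1 (test_point kd (f j (z.1, z.2.1.1)) (f j' (z.1, z.2.1.2))), z.2.2)
  end.
have dT' o : Def S (T' o).
  case: o => [[[[[a b] j] j']|[j i]]|[[[kd j] j'] w]].
  - by case: a; case: b; rewrite /T'; def_auto.
  - by have [dE _ _] := hE j; have dEi := dE i; rewrite /T'; move: (projT2 (E j) i) dEi => Ei dEi; def_auto.
  - rewrite /T'.
    have d1 : Dmap S (fun z : 'rV[R]_k * (Y * Y * Y) =>
        test_point kd (f j (z.1, z.2.1.1)) (f j' (z.1, z.2.1.2))).
      by apply: Dmap_test_point; def_auto.
    pose h (z : 'rV[R]_k * (Y * Y * Y)) :=
      test_point kd (f j (z.1, z.2.1.1)) (f j' (z.1, z.2.1.2)).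
    have {}d1 : Dmap S h by [].
    change (Def S (fun z : 'rV[R]_k * (Y * Y * Y) => T w (snoc z.1 (h z), z.2.2))).
    by clearbody h; def_auto.
have [I [A [C0 [dA hA]]]] := IH _ _ T' dT'.
pose i0 : 'I_(k.+1.*2) := ord0.
pose i1 : 'I_(k.+1.*2) := lift ord0 ord0.
pose i2 (c : 'I_(k.*2)) : 'I_(k.+1.*2) := lift ord0 (lift ord0 c).
pose A' (a : bool * bool * ('I_N.+1 * 'I_N.+1) * I)
    (z : 'rV[R]_k.+1 * ('I_(k.+1.*2) -> Y)) : Prop :=
  A a.2 (init z.1, fun c => ((component z.2 i0, component z.2 i1), component z.2 (i2 c))) /\
  in_piece a.1.1 (f a.1.2.1 (init z.1, component z.2 i0))
    (f a.1.2.2 (init z.1, component z.2 i1)) (z.1 ord0 ord_max).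
exists (bool * bool * ('I_N.+1 * 'I_N.+1) * I)%type, A', (4 * N.+1 ^ 2 * C0.+1)%N; split.
  move=> [[kd [j j']] a]; rewrite /A'; apply: Def_and => /=; first by def_auto.
  by apply: Def_in_piece; def_auto.
move=> n y n0.
pose P := ('I_N.+1 * 'I_n)%type.
pose g (x : 'rV[R]_k) (p : P) : R := f p.1 (x, y p.2).
have [DD hDD] := choice (fun ii : 'I_n * 'I_n => hA n (fun m => ((y ii.1, y ii.2), y m)) n0).
pose cell kd (p q : P) (B : set 'rV[R]_k) : set 'rV[R]_k.+1 :=
  [set z | B (init z) /\ in_piece kd (g (init z) p) (g (init z) q) (z ord0 ord_max)].
pose valid kd (p q : P) (B : set 'rV[R]_k) := [/\ DD (p.2, q.2) B,
  kd <> (true, true) -> q = p & forall x, B x -> piece_ok (g x) kd p q].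
pose D : set (set 'rV[R]_k.+1) := [set B' | exists kd p q B, valid kd p q B /\ B' = cell kd p q B].
have okB kd (p q : P) B x x' : DD (p.2, q.2) B -> B x -> B x' ->
    piece_ok (g x) kd p q -> piece_ok (g x') kd p q.
  move=> DB Bx Bx'; have [_ _ _ ad _] := hDD (p.2, q.2).
  have ad' o m : T' o (x, (y p.2, y q.2, y m)) <-> T' o (x', (y p.2, y q.2, y m)).
    by split; [apply: (ad B o m x x')|apply: (ad B o m x' x)].
  apply: piece_ok_ext => r; split.
  - exact: (ad' (inl (inl (true, true, p.1, r.1))) r.2).
  - exact: (ad' (inl (inl (true, false, p.1, r.1))) r.2).
  - exact: (ad' (inl (inl (false, true, q.1, r.1))) r.2).
  - exact: (ad' (inl (inl (false, false, q.1, r.1))) r.2).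
have uniqD kd p q B kd' p' q' B' z : valid kd p q B -> valid kd' p' q' B' ->
    cell kd p q B z -> cell kd' p' q' B' z -> [/\ kd = kd', p = p', q = q' & B = B'].
  move=> [DB e ok] [DB' e' ok'] [Bz inz] [Bz' inz'].
  have [E1 E2 E3] := piece_disjoint (ok _ Bz) inz e (ok' _ Bz') inz' e'.
  split=> //; have [_ [_ _ un] _ _ _] := hDD (p.2, q.2).
  by apply: (un B B' (init z)) => //; rewrite E2 E3.
have contB (p : P) (i j : 'I_n) B : DD (i, j) B -> definable_continuous S B (fun x => g x p).
  move=> DB; have [sh [_ ne _] _ ad _] := hDD (i, j); split.
    apply/definable_Def => //; have [a [ii ->]] := sh B DB.
    change (Def S (fun z : 'rV[R]_k.+1 => A a (init z, fun c => (y i, y j, y (ii c))) /\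
      f p.1 (init z, y p.2) = z ord0 ord_max)).
    by def_auto.
  have [_ covE contE] := hE p.1; have [x0 Bx0] := ne B DB.
  have [e Ee] := covE (x0, y p.2).
  have sub x : B x -> projT2 (E p.1) e (x, y p.2).
    by move=> Bx; apply: (ad B (inl (inr (existT _ p.1 e))) p.2 x0 x).
  apply: cont_on_within => x Bx e' e'0.
  have [d [d0 hd]] := contE e (y p.2) x (sub x Bx) e' e'0.
  by exists d; split=> // x' /sub; apply: hd.
exists D; split.
- move=> _ [kd [p [q [B [[DB _ _] ->]]]]].
  have [sh _ _ _ _] := hDD (p.2, q.2); have [a [ii ->]] := sh B DB.
  exists (kd, (p.1, q.1), a).
  exists (fun c => if unlift ord0 c is Some c' then
    if unlift ord0 c' is Some c'' then ii c'' else q.2 else p.2).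
  rewrite predeqE => z; rewrite /cell /A' /component /= unlift_none liftK unlift_none.
  suff -> : (fun c => (y p.2, y q.2, y (if unlift ord0 (i2 c) is Some c' then
    if unlift ord0 c' is Some c'' then ii c'' else q.2 else p.2))) =
    (fun c => (y p.2, y q.2, y (ii c))) by [].
  by apply/funext => c; rewrite /i2 !liftK.
- split.
  + move=> z; have [kd [p [q [ok inz e]]]] :=
      piece_cover (g (init z)) (z ord0 ord_max) (ord0, Ordinal n0).
    have [_ [cov _ _] _ _ _] := hDD (p.2, q.2); have [B [DB Bz]] := cov (init z).
    exists (cell kd p q B); split=> //; exists kd, p, q, B; split=> //; split=> // x Bx.
    exact: (okB kd p q B (init z) x DB Bz Bx ok).
  + move=> _ [kd [p [q [B [[DB _ ok] ->]]]]].
    have [_ [_ ne _] _ _ _] := hDD (p.2, q.2); have [x Bx] := ne B DB.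
    suff [t ht] : exists t, in_piece kd (g x p) (g x q) t.
      by exists (snoc x t); rewrite /cell /= init_snoc last_snoc.
    exists (test_point kd (g x p) (g x q)); have := ok x Bx.
    by case: kd {ok} => [[] []] //=; [move=> []|..]; lra.
  + move=> _ _ z [kd [p [q [B [v ->]]]]] [kd' [p' [q' [B' [v' ->]]]]] c c'.
    by have [-> -> -> ->] := uniqD _ _ _ _ _ _ _ _ _ v v' c c'.
- move=> _ [kd [p [q [B [[DB e ok] ->]]]]].
  have [_ _ cyl _ _] := hDD (p.2, q.2); have cB := cyl B DB.
  have bb (e0 : \bar R) r : band_bound S B e0 (fun x => (g x r)%:E).
    by left; exists (fun x => g x r); split=> //; apply: contB DB.
  have bi (e0 : \bar R) : band_bound S B e0 (fun _ => e0) by right.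
  case: kd e ok => [[] []] e ok.
  + have := cylindrical_from0_band cB (bb _ p) (bb _ q).
    rewrite (_ : band_over _ _ _ = cell (true, true) p q B); last first.
      rewrite predeqE => z; rewrite /band_over /cell /= !lte_fin.
      by split=> [[]|[? []]].
    by apply=> x /ok[_ _ pq _]; rewrite lte_fin.
  + have := cylindrical_from0_band cB (bb _ p) (bi _).
    rewrite (_ : band_over _ _ _ = cell (true, false) p q B); last first.
      by rewrite predeqE => z; rewrite /band_over /cell /= lte_fin ltry; split=> [[]|[]].
    by apply=> x _; rewrite ltry.
  + have := cylindrical_from0_band cB (bi _) (bb _ p).
    rewrite (_ : band_over _ _ _ = cell (false, true) p q B); last first.
      by rewrite predeqE => z; rewrite /band_over /cell /= lte_fin ltNyr; split=> [[]|[]].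
    by apply=> x _; rewrite ltNyr.
  + have := cylindrical_from0_graph cB (contB p _ _ B DB).
    by rewrite (_ : graph_over _ _ = cell (false, false) p q B).
- move=> _ w m z z' [kd [p [q [B [[DB _ ok] ->]]]]].
  have test x t : B x -> in_piece kd (g x p) (g x q) t ->
      (T w (snoc x t, y m) <-> T w (snoc x (test_point kd (g x p) (g x q)), y m)).
    move=> Bx inz; have [<- //|[a [b [[at_ tb] [as_ sb] free]]]] := piece_gap (ok x Bx) inz.
    have dTx : Def S (fun t : R => T w (snoc x t, y m)) by def_auto.
    have loc s : a < s -> s < b -> exists d : R, 0 < d /\ forall s', `|s' - s| < d ->
        (T w (snoc x s', y m) <-> T w (snoc x s, y m)).
      by move=> as1 sb1; apply: hf => j; apply: (free s (j, m)).
    by split; apply: (locally_constant dTx loc).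
  elim/snocP: z => x t; elim/snocP: z' => x' t'.
  rewrite /cell /= !init_snoc !last_snoc => -[Bx inx] [Bx' inx'].
  rewrite (test x t Bx inx) (test x' t' Bx' inx').
  have [_ _ _ ad _] := hDD (p.2, q.2).
  exact: (ad B (inr (kd, p.1, q.1, w)) m x x').
(* For [k = 0] a piece is determined by its first end alone, which gives the bound
   linear in [n] instead of a quadratic one. *)
- have count_pairs : enumerable_by D (4 * (N.+1 * n * (N.+1 * n)) * (C0 * n ^ (k.*2).-1)).
    have /choice[e he] : forall ii, exists e : 'I_(C0 * n ^ (k.*2).-1) -> set 'rV[R]_k,
        forall B, DD ii B -> exists c, B = e c by move=> ii; have [] := hDD ii.
    apply: (@enumerable_by_fin _ _ (bool * bool * (P * P) * 'I_(C0 * n ^ (k.*2).-1))%type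
      (fun c => cell c.1.1 c.1.2.1 c.1.2.2 (e (c.1.2.1.2, c.1.2.2.2) c.2))).
      by rewrite !card_prod !card_ord !card_bool.
    move=> _ [kd [p [q [B [[DB _ _] ->]]]]]; have [c ->] := he _ B DB.
    by exists (kd, (p, q), c).
  have count_ends : k = 0%N -> enumerable_by D (4 * (N.+1 * n)).
    move=> k0.
    have /choice[e he] : forall kp : bool * bool * P, exists B' : set 'rV[R]_k.+1,
        forall q B, valid kp.1 kp.2 q B -> B' = cell kp.1 kp.2 q B.
      move=> [kd p] /=; have [[q [B v]]|nv] := pselect (exists q B, valid kd p q B); last first.
        by exists setT => q B v; exfalso; apply: nv; exists q, B.
      exists (cell kd p q B) => q' B' v'.
      move: v v' => [DB e ok] [DB' e' ok'].
      have [_ _ cyl _ _] := hDD (p.2, q.2); have [_ _ cyl' _ _] := hDD (p.2, q'.2).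
      have BE := cylindrical_from0_full k0 (cyl B DB).
      have BE' := cylindrical_from0_full k0 (cyl' B' DB').
      rewrite BE BE'; rewrite BE in ok; rewrite BE' in ok'.
      by rewrite (piece_right_end (ok 0 Logic.I) e (ok' 0 Logic.I) e').
    apply: (@enumerable_by_fin _ _ (bool * bool * P)%type e).
      by rewrite !card_prod !card_ord !card_bool.
    by move=> _ [kd [p [q [B [v ->]]]]]; exists (kd, p); rewrite (he (kd, p) q B v).
  have [k0|k_gt0] := posnP k.
    apply: enumerable_by_le (count_ends k0); rewrite k0 /= expn1.
    rewrite -!mulnA leq_mul2l /= -[n in leqLHS]mul1n.
    by rewrite leq_mul2l /= [leqRHS]mulnA leq_mul2r muln_gt0 orbT.
  apply: enumerable_by_le count_pairs.
  have -> : (k.+1.*2).-1 = (k.*2).-1.+2 by rewrite doubleS /= prednK // double_gt0.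
  have -> : (4 * (N.+1 * n * (N.+1 * n)) * (C0 * n ^ (k.*2).-1) =
    4 * N.+1 ^ 2 * C0 * n ^ (k.*2).-1.+2)%N by rewrite !expnS expn0; ring.
  by rewrite leq_mul2r leq_mul2l leqnSn !orbT.
Qed.

Lemma decomposition_exists k : decomposable k.
Proof. by elim: k => [|k IH]; [apply: decomposable0|apply: decomposable_step]. Qed.

End Decomposition.

Section Assembly.
Set Implicit Arguments.
Unset Strict Implicit.
Unset Printing Implicit Defensive.
Local Open Scope classical_set_scope.
Local Open Scope ring_scope.
Local Open Scope card_scope.

Variables (R : rcfType) (S : ominimal_structure R).

Lemma card_le_fin_image (T : Type) (F : finType) (e : F -> T) (D : set T) :
  (forall B, D B -> exists c, B = e c) -> D #<= `I_#|F|.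
Proof.
move=> h; apply: (@card_le_trans _ _ _ [set: 'I_#|F|]); last first.
  by have := @card_II #|F|; rewrite card_eq_le => /andP[].
apply: card_le_trans (card_image_le (fun c => e (enum_val c)) setT).
by apply: subset_card_le => B /h[c ->]; exists (enum_rank c) => //=; rewrite enum_rankK.
Qed.

Lemma Dmap_concat_row (E : dtype R) k m l (f : E -> 'rV[R]_(k + m * l)) (j : 'I_m) :
  Dmap S f -> Dmap S (fun w => row j (vec_mx (rsubmx (f w)))).
Proof.
move=> df; apply: Dmap_row => c.
apply: (Dmap_ext (f := fun w => f w ord0 (rshift k (mxvec_index j c)))); last by def_auto.
by move=> w; rewrite !mxE.
Qed.

Lemma Dmap_lsubmx (E : dtype R) k m (f : E -> 'rV[R]_(k + m)) :
  Dmap S f -> Dmap S (fun w => lsubmx (f w)).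
Proof.
move=> df; apply: Dmap_row => c.
apply: (Dmap_ext (f := fun w => f w ord0 (lshift m c))); last by def_auto.
by move=> w; rewrite !mxE.
Qed.

Lemma Dmap_row_mx (E : dtype R) k m (f : E -> 'rV[R]_k) (g : E -> 'rV[R]_m) :
  Dmap S f -> Dmap S g -> Dmap S (fun w => row_mx (f w) (g w)).
Proof.
move=> df dg; apply: Dmap_row => c; case: (fintype.splitP c) => i e.
  apply: (Dmap_ext (f := fun w => f w ord0 i)); last by def_auto.
  by move=> w; rewrite (_ : c = lshift m i) ?row_mxEl //; apply: val_inj.
apply: (Dmap_ext (f := fun w => g w ord0 i)); last by def_auto.
by move=> w; rewrite (_ : c = rshift k i) ?row_mxEr //; apply: val_inj.
Qed.

Lemma row_concat m l (y : 'I_m -> 'rV[R]_l) j : row j (vec_mx (concat y)) = y j.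
Proof. by rewrite /concat mxvecK rowK. Qed.

End Assembly.



Local Open Scope classical_set_scope.
Local Open Scope card_scope.

Theorem mainTheorem4 (R : rcfType) (S : ominimal_structure R) (k l : nat)
    (k_gt0 : (0 < k)%N) (l_gt0 : (0 < l)%N)
    (T : set 'rV[R]_(k + l)) (T_def : definable S T) :
  exists (C1 C2 : nat) (AA : set (set 'rV[R]_(k + 2 * (2 ^ k - 1) * l))),
    [/\ finite_set AA,
        AA #<= `I_C1,
        (forall A, AA A -> definable S A) &
        forall (n : nat) (y : 'I_n -> 'rV[R]_l), (0 < n)%N ->
        exists D : set (set 'rV[R]_k),
          [/\ D `<=` [set B | exists (A : set 'rV[R]_(k + 2 * (2 ^ k - 1) * l))
                                (i : 'I_(2 * (2 ^ k - 1)) -> 'I_n),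
                        AA A /\
                        B = proj_slice A (concat (fun j => y (i j)))],
              semi_cylindrical_decomposition S D,
              adapted D (fun i => fiber T (y i)) &
              D #<= `I_(C2 * n ^ (2 * k - 1))]].
Proof.
have dT : Def S (fun z : 'rV[R]_k * 'rV[R]_l => T (row_mx z.1 z.2)).
  have kl : (0 < k + l)%N by rewrite addn_gt0 k_gt0.
  have T_Def := proj1 (@definable_Def R S _ T kl) T_def.
  apply: Def_subst T_Def (Dmap_row_mx _ _); def_auto.
have [I [A [C [dA hA]]]] := decomposition_exists (fun _ : unit => dT).
(* The [2 * k] parameters of the construction are placed first among the [2 * (2 ^ k - 1)]. *)
have kp : (k.*2 <= 2 * (2 ^ k - 1))%N.
  by rewrite -mul2n leq_mul2l /= -ltnS subn1 prednK ?expn_gt0 // ltn_expl.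
pose A' (a : I) : set 'rV[R]_(k + 2 * (2 ^ k - 1) * l) :=
  [set w | A a (lsubmx w, fun c => row (widen_ord kp c) (vec_mx (rsubmx w)))].
pose AA := A' @` [set: I].
have AA_card : AA #<= `I_#|I|.
  by apply: (card_le_fin_image (e := A')) => _ [a _ <-]; exists a.
exists #|I|, C, AA; split=> //.
- exact: card_le_finite AA_card (finite_II _).
- move=> _ [a _ <-]; apply/definable_Def; first by rewrite addn_gt0 k_gt0.
  apply: (Def_subst (dA a)); apply: Dmap_pair; first by apply: Dmap_lsubmx; def_auto.
  by apply: Dmap_lam => c; apply: Dmap_concat_row; def_auto.
move=> n y n0; have [D [sh [cov ne un] cyl ad [e he]]] := hA n y n0.
exists D; split.
- move=> B /sh[a [i ->]].
  exists (A' a), (fun c => if insub (val c) is Some c' then i c' else Ordinal n0).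
  split; first by exists a.
  set w := concat _.
  have wE c : row (widen_ord kp c) (vec_mx w) = y (i c).
    rewrite /w row_concat (_ : val (widen_ord kp c) = val c) //.
    by rewrite valK.
  have {}wE : (fun c => row (widen_ord kp c) (vec_mx w)) = (fun c => y (i c)).
    exact/funext.
  rewrite predeqE => x; rewrite /proj_slice /A' /=; split.
    by move=> Ax; exists (row_mx x w); rewrite row_mxKl // row_mxKr wE.
  by move=> [v [/= vw]]; rewrite vw wE => Av <-.
- split.
  + split.
    * rewrite predeqE => x; split=> // _; have [B [DB Bx]] := cov x; by exists B.
    * by move=> B B' DB DB' [x [Bx Bx']]; apply: (un B B' x).
    * by move=> B /ne[x Bx]; exists x.
  + move=> B /sh[a [i ->]]; apply/definable_Def => //.
    have dAa := dA a.
    change (Def S (fun x : 'rV[R]_k => A a (x, fun c => y (i c)))).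
    by def_auto.
  + by move=> B /cyl; clear -k_gt0; case: k k_gt0 B.
- move=> B i DB; have [[x [Bx Tx]]|nT] := pselect (exists x, B x /\ fiber T (y i) x).
    by left=> x' Bx'; apply: (ad B tt i x x' DB Bx Bx' Tx).
  by right; rewrite predeqE => x; split=> // -[Bx Tx]; case: nT; exists x.
- have := card_le_fin_image he; rewrite card_ord.
  by rewrite -mul2n -subn1.
Qed.
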